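(* There exist $\beta_0>0$ and $L>0$ such that for all $\beta\le\beta_0$, all $N\ge1$, all $(t_1,\dots,t_N)$ with $\sum_{i\le N}t_i^2=1$ and all integers $k\ge1$, $$\nu\Bigl(\Bigl(\sum_{i=1}^N t_i\bar\sigma_i\Bigr)^{2k}\Bigr)\le (Lk)^k,$$ where $\bar\sigma=\sigma^1-\sigma^2$.
   Context: Sherrington–Kirkpatrick model: $\Sigma_N=\{-1,1\}^N$; $(g_{ij})$ i.i.d. standard Gaussians; $\beta>0,h\ge0$; $-H_N(\sigma)=\frac{\beta}{\sqrt N}\sum_{1\le i<j\le N}g_{ij}\sigma_i\sigma_j+h\sum_i\sigma_i$; Gibbs measure $G\propto e^{-H_N}$. $\sigma^1,\sigma^2$ are two independent replicas (i.i.d. with law $G$ given the disorder), $\langle\cdot\rangle$ the Gibbs expectation over replicas, and $\nu(f)=\mathbb{E}\langle f\rangle$ with $\mathbb{E}$ over the disorder. *)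

(* Defs.v *)
From HB Require Import structures.
From mathcomp Require Import all_boot all_order all_algebra.
From mathcomp Require Import all_classical all_reals all_analysis.
Set Implicit Arguments. Unset Strict Implicit. Unset Printing Implicit Defensive.
Import Order.TTheory GRing.Theory Num.Theory.
Local Open Scope ring_scope.

Section SK.
Variable R : realType.

Definition spin (b : bool) : R := if b then 1 else -1.

(* Expectation of F(g_0,...,g_{n-1}) where g_0,...,g_{n-1} are i.i.d.
   standard Gaussians, as an iterated integral against the standard
   normal probability measure (variables >= n are set to 0). *)
Fixpoint gauss_exp (n : nat) (F : (nat -> R) -> R) : R :=
  match n with
  | 0 => F (fun _ => 0)
  | m.+1 => Rintegral (normal_prob (0:R) 1) setT
              (fun x : R => gauss_exp m (fun g => F (fun k => if k == m then x else g k)))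
  end.

(* -H_N(sigma) with disorder g : indices (i,j) encoded as i*N + j; only i<j used *)
Definition minusH (N : nat) (beta h : R) (g : nat -> R) (s : {ffun 'I_N -> bool}) : R :=
  beta / Num.sqrt (N%:R) *
    (\sum_(i < N) \sum_(j < N | (i < j)%N) g (i * N + j)%N * spin (s i) * spin (s j))
  + h * \sum_(i < N) spin (s i).

Definition gibbs2 (N : nat) (beta h : R) (g : nat -> R)
    (f : {ffun 'I_N -> bool} -> {ffun 'I_N -> bool} -> R) : R :=
  (\sum_(s1 : {ffun 'I_N -> bool}) \sum_(s2 : {ffun 'I_N -> bool})
     f s1 s2 * expR (minusH beta h g s1) * expR (minusH beta h g s2))
  / (\sum_(s : {ffun 'I_N -> bool}) expR (minusH beta h g s)) ^+ 2.

Definition nu2 (N : nat) (beta h : R)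
    (f : {ffun 'I_N -> bool} -> {ffun 'I_N -> bool} -> R) : R :=
  gauss_exp (N * N) (fun g => gibbs2 beta h g f).

End SK.

(* Main.v *)
(* The Gibbs measure is handled for a fixed disorder. With A the symmetric matrix of
   couplings beta g_ij / sqrt N, the variance of a linear form under the Gibbs measure in
   every external field is at most 3 times its squared norm as soon as the operator norm
   of A is at most 1/16. To see this, write A + 1/16 = sum_k v_k v_k^T and build up the
   weight exp(1/2 sum_k (v_k . sigma)^2) by m^2 multiplications with
   prod_k cosh((v_k . sigma) / m), which averages the external field over the signed sums
   of the v_k / m. By the law of total variance one such step turns a bound c valid in all
   fields into c + (c^2 / 8 + o(1)) / m^2: a discrete maximum principle for the Hessian of
   log Z. Since this Hessian is the covariance in the tilted field,
   Z(h + l) Z(h - l) <= Z(h)^2 exp(3 |l|^2), and the moments follow.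
   For beta small the operator norm is at most 1/16 outside an event of probability
   O(exp(- 3 N)), by a lattice net; there the trivial bound (4 N)^k suffices because
   N^k exp(- N) <= k^k. *)
Require Import Defs.
From HB Require Import structures.
From mathcomp Require Import all_boot all_order all_algebra.
From mathcomp Require Import all_classical all_reals all_analysis.
From mathcomp Require Import measurable_realfun ring lra.
Import Order.TTheory GRing.Theory Num.Theory.
Import numFieldTopology.Exports numFieldNormedType.Exports.
Set Implicit Arguments. Unset Strict Implicit. Unset Printing Implicit Defensive.
Local Open Scope classical_set_scope.
Local Open Scope ring_scope.

(** * Scalar inequalities *)

Section ScalarInequalities.
Variable R : realType.
Implicit Types x y z : R.

Lemma derive_ge0_nondecreasing (f df : R -> R) (y : R) :
  (forall x, is_derive x (1 : R) f (df x)) ->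
  (forall x, 0 <= x -> 0 <= df x) -> 0 <= y -> f 0 <= f y.
Proof.
move=> fdf df0 y0; rewrite -subr_ge0.
have [|c c0y ->] := @MVT_segment _ f df 0 y y0 (fun x _ => fdf x).
  apply: continuous_subspaceT => x; apply: differentiable_continuous.
  by apply/derivable1_diffP; exact: (@ex_derive _ _ _ _ _ _ _ (fdf x)).
by rewrite subr0 mulr_ge0 // df0 //; move: c0y; rewrite in_itv => /andP[].
Qed.

(** The upper half comes from [exp(-y) >= 1 - y], that is [(1 - y) exp y <= 1], since
    [(1 - y)(1 + y + 2 y^2) >= 1] for [y <= 1/2]. *)
Lemma expR_taylor1 y : `|y| <= 2^-1 -> 0 <= expR y - 1 - y <= 2 * y ^+ 2.
Proof.
rewrite ler_norml => /andP[y1 y2].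
have e1 := expR_ge1Dx y; have := expR_ge1Dx (- y); rewrite expRN => e2.
have e0 := expR_gt0 y.
apply/andP; split; first by lra.
have : (1 - y) * expR y <= 1 by rewrite -ler_pdivlMr // div1r.
nra.
Qed.

Definition cosh y := (expR y + expR (- y)) / 2.

Lemma coshN y : cosh (- y) = cosh y.
Proof. by rewrite /cosh opprK addrC. Qed.

Lemma expR_subN_ge y : 0 <= y -> 2 * y <= expR y - expR (- y).
Proof.
move=> y0; rewrite -subr_ge0.
have := @derive_ge0_nondecreasing (fun x => expR x - expR (- x) - 2 * x)
  (fun x => expR x + expR (- x) - 2) y.
rewrite /= oppr0 expR0 mulr0 !subrr; apply => // x.
  apply: is_derive_eq; rewrite /GRing.scale /=; ring.
move=> _; have := expR_ge1Dx x; have := expR_ge1Dx (- x); lra.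
Qed.

Lemma cosh_lower y : 1 + y ^+ 2 / 2 <= cosh y.
Proof.
wlog y0 : y / 0 <= y.
  move=> H; have [/H//|/ltW y0] := leP 0 y.
  by rewrite -coshN -sqrrN; apply: H; rewrite oppr_ge0.
have := @derive_ge0_nondecreasing (fun x => expR x + expR (- x) - x ^+ 2)
  (fun x => expR x - expR (- x) - 2 * x) y.
rewrite /= oppr0 expR0 /cosh => /(_ _ _ y0) H.
suff : 1 + 1 - 0 ^+ 2 <= expR y + expR (- y) - y ^+ 2 by lra.
apply: H => [x|x x0]; last by have := expR_subN_ge x0; lra.
apply: is_derive_eq; rewrite /GRing.scale /=; ring.
Qed.

(** On [x >= 0] the function [(exp x + exp(-x)) exp(-x^2/2)] decreases: minus its derivative is
    [exp(-x^2/2) f3 x], where [f3 0 = 0] and [f3] has derivative [x (exp x - exp(-x)) >= 0]. *)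
Lemma cosh_upper y : cosh y <= expR (y ^+ 2 / 2).
Proof.
wlog y0 : y / 0 <= y.
  move=> H; have [/H//|/ltW y0] := leP 0 y.
  by rewrite -coshN -sqrrN; apply: H; rewrite oppr_ge0.
pose f3 x := x * (expR x + expR (- x)) - (expR x - expR (- x)).
have f3_ge0 x : 0 <= x -> 0 <= f3 x.
  move=> x0; have := @derive_ge0_nondecreasing f3
    (fun x => x * (expR x - expR (- x))) x.
  rewrite [f3 0]/f3 mul0r oppr0 subrr subr0; apply => // z.
    by rewrite /f3; apply: is_derive_eq; rewrite /GRing.scale /=; ring.
  move=> z0; rewrite mulr_ge0 //; have := expR_subN_ge z0; lra.
have := @derive_ge0_nondecreasing
  (fun x => - ((expR x + expR (- x)) * expR (- (x ^+ 2 / 2))))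
  (fun x => expR (- (x ^+ 2 / 2)) * f3 x) y.
rewrite oppr0 expR0 expr0n /= mul0r oppr0 expR0 mulr1 => H.
have {}H : (expR y + expR (- y)) * expR (- (y ^+ 2 / 2)) <= 2.
  rewrite -lerN2; apply: (le_trans _ (H _ _ y0)) => [|x|x x0]; first by lra.
    by rewrite /f3; apply: is_derive_eq; rewrite /GRing.scale /=; field.
  by rewrite /= mulr_ge0 ?expR_ge0 ?f3_ge0.
by move: H; rewrite /cosh (expRN (y ^+ 2 / 2)) ler_pdivrMr ?expR_gt0 // => H; lra.
Qed.

(** With [z = y^2/2], the bound [exp(z - z^2) <= 1 + z] follows from [exp(z^2 - z) >= 1 - z + z^2]
    and [(1 + z)(1 - z + z^2) = 1 + z^3]. *)
Lemma cosh_upper_sharp y : expR (y ^+ 2 / 2 - y ^+ 4 / 4) <= cosh y.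
Proof.
apply: le_trans (cosh_lower y); set z := y ^+ 2 / 2.
have -> : y ^+ 4 / 4 = z ^+ 2 by rewrite /z; field.
have z0 : 0 <= z by rewrite /z divr_ge0 ?sqr_ge0.
have e := expR_ge1Dx (z ^+ 2 - z).
have e0 := expR_gt0 (z ^+ 2 - z).
rewrite -[z - _]opprB expRN -div1r ler_pdivrMr //.
apply: (@le_trans _ _ ((1 + z) * (1 + (z ^+ 2 - z)))).
  by have := exprn_ge0 3 z0; nra.
by rewrite ler_wpM2l //; lra.
Qed.

Lemma pow_le_fact_exp n x : 0 <= x -> x ^+ n <= n`!%:R * expR x.
Proof.
case: n => [|n] x0; first by rewrite expr0 fact0 mul1r -expR0 ler_expR.
have := expR_ge1Dxn n x0; have f0 : 0 < (n.+1)`!%:R :> R by rewrite ltr0n fact_gt0.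
move=> h; rewrite mulrC -ler_pdivrMr //; lra.
Qed.

End ScalarInequalities.

(** * Weighted averages over finite sets *)

Section FiniteAverages.
Variable R : realType.

Lemma ler_of_sqr (x y : R) : 0 <= y -> x ^+ 2 <= y ^+ 2 -> x <= y.
Proof.
move=> y0; rewrite -ler_sqrt ?sqr_ge0 // !sqrtr_sqr (ger0_norm y0).
by apply: le_trans; exact: ler_norm.
Qed.

Lemma discriminant_le0 (A B C : R) : 0 <= C ->
  (forall t, 0 <= A + 2 * t * B + t ^+ 2 * C) -> B ^+ 2 <= A * C.
Proof.
move=> C0 H; have [CZ|CN] := eqVneq C 0.
  have [->|BN] := eqVneq B 0; first by rewrite CZ mulr0 expr0n.
  have := H (- (A + 1) / (2 * B)); rewrite CZ.
  have -> : A + 2 * (- (A + 1) / (2 * B)) * B + (- (A + 1) / (2 * B)) ^+ 2 * 0 = -1.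
    by field.
  lra.
have Cp : 0 < C by rewrite lt_neqAle eq_sym CN.
have := H (- B / C).
have -> : A + 2 * (- B / C) * B + (- B / C) ^+ 2 * C = A - B ^+ 2 / C by field.
by rewrite subr_ge0 ler_pdivrMr.
Qed.

Lemma cauchy_schwarz_sum (T : finType) (w f g : T -> R) : (forall x, 0 <= w x) ->
  (\sum_x w x * f x * g x) ^+ 2 <=
  (\sum_x w x * f x ^+ 2) * (\sum_x w x * g x ^+ 2).
Proof.
move=> w0; apply: discriminant_le0 => [|t].
  by apply: sumr_ge0 => x _; rewrite mulr_ge0 ?sqr_ge0.
have -> : \sum_x w x * f x ^+ 2 + 2 * t * (\sum_x w x * f x * g x) +
   t ^+ 2 * (\sum_x w x * g x ^+ 2) = \sum_x w x * (f x + t * g x) ^+ 2.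
  by rewrite !mulr_sumr -!big_split /=; apply: eq_bigr => x _; ring.
by apply: sumr_ge0 => x _; rewrite mulr_ge0 ?sqr_ge0.
Qed.

Definition av (T : finType) (w f : T -> R) := (\sum_x w x * f x) / \sum_x w x.

Lemma sum_centered (T : finType) (w f : T -> R) : 0 < \sum_x w x ->
  \sum_x w x * (f x - av w f) = 0.
Proof.
move=> Z0; under eq_bigr do rewrite mulrBr.
by rewrite sumrB -mulr_suml /av mulrC divfK ?subrr // gt_eqF.
Qed.

Lemma sum_sqr_shift (T : finType) (w f : T -> R) (c : R) : 0 < \sum_x w x ->
  \sum_x w x * (f x - c) ^+ 2 =
  \sum_x w x * (f x - av w f) ^+ 2 + (\sum_x w x) * (av w f - c) ^+ 2.
Proof.
move=> Z0; set m := av w f.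
transitivity (\sum_x (w x * (f x - m) ^+ 2 + 2 * (m - c) * (w x * (f x - m)) +
   w x * (m - c) ^+ 2)); first by apply: eq_bigr => x _; ring.
by rewrite !big_split /= -mulr_sumr sum_centered // mulr0 addr0 -mulr_suml.
Qed.

(** Flipping coordinate [j] changes neither [q] nor the other factors and pairs the terms so that
    each pair cancels. This is the vanishing covariance of independent variables. *)
Lemma indep_sum0 (n : nat) (p g : 'I_n -> bool -> R) (j : 'I_n) :
  \sum_b p j b * g j b = 0 ->
  forall q : {ffun 'I_n -> bool} -> R,
  (forall e e' : {ffun 'I_n -> bool}, (forall i, i != j -> e i = e' i) -> q e = q e') ->
  \sum_(e : {ffun 'I_n -> bool}) (\prod_i p i (e i)) * g j (e j) * q e = 0.
Proof.
move=> pg q qj.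
pose fl (e : {ffun 'I_n -> bool}) : {ffun 'I_n -> bool} :=
  [ffun i => if i == j then ~~ e i else e i].
have flK : involutive fl.
  by move=> e; apply/ffunP => i; rewrite !ffunE; case: eqP => // _; rewrite negbK.
pose F (e : {ffun 'I_n -> bool}) := (\prod_i p i (e i)) * g j (e j) * q e.
have FE e : F e + F (fl e) = 0.
  rewrite /F (bigD1 j) //= [in X in _ + X](bigD1 j) //=.
  have -> : q (fl e) = q e by apply: qj => i /negbTE ij; rewrite ffunE ij.
  have -> : \prod_(i | i != j) p i (fl e i) = \prod_(i | i != j) p i (e i).
    by apply: eq_bigr => i /negbTE ij; rewrite ffunE ij.
  rewrite !ffunE eqxx; set P := \prod_(i | _) _.
  have : p j (e j) * g j (e j) + p j (~~ e j) * g j (~~ e j) = 0.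
    by rewrite -pg big_bool; case: (e j) => //=; rewrite addrC.
  by move=> H; transitivity ((p j (e j) * g j (e j) + p j (~~ e j) * g j (~~ e j)) * P * q e);
    [ring | rewrite H !mul0r].
have : \sum_e F e + \sum_e F e = 0.
  rewrite {2}(reindex_inj (inv_inj flK)) -big_split /=.
  by rewrite big1 // => e _; exact: FE.
by rewrite -/(F _) -mulr2n => /eqP; rewrite mulrn_eq0 /= => /eqP.
Qed.

Lemma indep_sum_sqr (n : nat) (p g : 'I_n -> bool -> R) :
  (forall j, \sum_b p j b * g j b = 0) ->
  \sum_(e : {ffun 'I_n -> bool}) (\prod_i p i (e i)) * (\sum_j g j (e j)) ^+ 2 =
  \sum_j \sum_(e : {ffun 'I_n -> bool}) (\prod_i p i (e i)) * g j (e j) ^+ 2.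
Proof.
move=> pg; transitivity (\sum_(e : {ffun 'I_n -> bool}) \sum_j \sum_k
    (\prod_i p i (e i)) * g j (e j) * g k (e k)).
  apply: eq_bigr => e _; rewrite expr2 mulr_suml mulr_sumr.
  by apply: eq_bigr => j _; rewrite !mulr_sumr; apply: eq_bigr => k _; rewrite mulrA.
rewrite exchange_big /=; apply: eq_bigr => j _.
rewrite exchange_big /= (bigD1 j) //= [X in _ + X]big1 ?addr0.
  by apply: eq_bigr => e _; rewrite -mulrA expr2.
move=> k kj; apply: (indep_sum0 (pg j) (q := fun e => g k (e k))) => e e' ee'.
by rewrite ee'.
Qed.

End FiniteAverages.

(** * Variance bounds in all external fields *)

Section VarianceBound.
Variables (R : realType) (N : nat).
Local Notation cube n := {ffun 'I_n -> bool}.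
Local Notation vec := ('I_N -> R).

Lemma spin_sqr b : spin R b ^+ 2 = 1.
Proof. by case: b; rewrite /spin ?sqrrN expr1n. Qed.

Lemma normr_spin b : `|spin R b| = 1.
Proof. by case: b; rewrite /spin ?normrN normr1. Qed.

Definition lin n (l : 'I_n -> R) (x : cube n) := \sum_i l i * spin R (x i).
Definition dotp (l m : vec) := \sum_i l i * m i.
Definition nrm2 n (l : 'I_n -> R) := \sum_i l i ^+ 2.

Lemma nrm2_ge0 n (l : 'I_n -> R) : 0 <= nrm2 l.
Proof. by apply: sumr_ge0 => i _; exact: sqr_ge0. Qed.

Lemma linD (l m : vec) x : lin (fun i => l i + m i) x = lin l x + lin m x.
Proof. by rewrite /lin -big_split; apply: eq_bigr => i _; rewrite mulrDl. Qed.

Lemma linZ c (l : vec) x : lin (fun i => c * l i) x = c * lin l x.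
Proof. by rewrite /lin mulr_sumr; apply: eq_bigr => i _; rewrite mulrA. Qed.

Lemma lin_sum n (c : 'I_n -> R) (v : 'I_n -> vec) x :
  lin (fun i => \sum_k c k * v k i) x = \sum_k c k * lin (v k) x.
Proof.
rewrite /lin; under eq_bigr do rewrite mulr_suml.
rewrite exchange_big; apply: eq_bigr => k _; rewrite mulr_sumr.
by apply: eq_bigr => i _; rewrite mulrA.
Qed.

Definition tilt (w : cube N -> R) (h : vec) x := w x * expR (lin h x).

(** The bound [Var(lin l) <= c |l|^2] multiplied through by the partition function. Requiring it in
    every field lets it pass to mixtures over fields. *)
Definition var_bounded (w : cube N -> R) (c : R) := forall h l : vec,
  \sum_x tilt w h x * (lin l x - av (tilt w h) (lin l)) ^+ 2 <=
  c * nrm2 l * \sum_x tilt w h x.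

Lemma cube_sum_gt0 n (w : cube n -> R) : (forall x, 0 < w x) -> 0 < \sum_x w x.
Proof.
move=> w0; rewrite (bigD1 [ffun=> true]) //= ltr_pwDl //.
by apply: sumr_ge0 => x _; exact: ltW.
Qed.

Lemma tilt_gt0 w h : (forall x, 0 < w x) -> forall x, 0 < tilt w h x.
Proof. by move=> w0 x; rewrite mulr_gt0 ?expR_gt0. Qed.

(** Start of the iteration: the spins are independent with mean [t i = tanh (h i)] and variance
    [1 - t i ^ 2 <= 1]. *)
Lemma var_bounded_product : var_bounded (fun=> 1) 1.
Proof.
move=> h l.
have pos := cube_sum_gt0 (tilt_gt0 h (fun x : cube N => @ltr01 R)).
pose p i b := expR (h i * spin R b).
pose t i := (p i true - p i false) / (p i true + p i false).
pose g i b := l i * (spin R b - t i).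
have p0 i b : 0 < p i b by exact: expR_gt0.
have pE x : tilt (fun=> 1) h x = \prod_i p i (x i) by rewrite /tilt mul1r expR_sum.
have pc i : \sum_b p i b * (spin R b - t i) = 0.
  rewrite big_bool /t /spin /=; have := p0 i true; have := p0 i false => p1 p2.
  by field; rewrite gt_eqF // addr_gt0.
have pg i : \sum_b p i b * g i b = 0.
  transitivity (l i * \sum_b p i b * (spin R b - t i)); last by rewrite pc mulr0.
  by rewrite mulr_sumr; apply: eq_bigr => b _; rewrite /g mulrCA.
have := sum_sqr_shift (lin l) (\sum_i l i * t i) pos => shift.
apply: (@le_trans _ _ (\sum_x tilt (fun=> 1) h x * (lin l x - \sum_i l i * t i) ^+ 2)).
  by rewrite shift lerDl mulr_ge0 ?sqr_ge0 // ltW.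
have -> : \sum_x tilt (fun=> 1) h x * (lin l x - \sum_i l i * t i) ^+ 2 =
    \sum_(x : cube N) (\prod_i p i (x i)) * (\sum_i g i (x i)) ^+ 2.
  apply: eq_bigr => x _; rewrite pE; congr (_ * _ ^+ 2).
  by rewrite /lin -sumrB; apply: eq_bigr => i _; rewrite -mulrBr.
rewrite indep_sum_sqr // mul1r /nrm2 mulr_suml; apply: ler_sum => i _.
have c0 : \sum_(x : cube N) (\prod_i p i (x i)) * (spin R (x i) - t i) * 1 = 0 :> R.
  exact: (@indep_sum0 _ _ p (fun i b => spin R b - t i) i (pc i) (fun=> 1)).
under eq_bigr do rewrite -pE.
have -> : \sum_(x : cube N) tilt (fun=> 1) h x * g i (x i) ^+ 2 =
    l i ^+ 2 * (1 - t i ^+ 2) * (\sum_(x : cube N) tilt (fun=> 1) h x) -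
    2 * l i ^+ 2 * t i * \sum_(x : cube N) (\prod_i p i (x i)) * (spin R (x i) - t i) * 1.
  rewrite !mulr_sumr -sumrB; apply: eq_bigr => x _; rewrite -pE /g exprMn sqrrB spin_sqr; ring.
rewrite c0 mulr0 subr0 ler_wpM2r ?(ltW pos) // ler_piMr ?sqr_ge0 //.
by rewrite lerBlDr lerDl sqr_ge0.
Qed.

Section Step.
Variables (n : nat) (v : 'I_n -> vec).

Definition cosh_weight s x := \prod_k cosh (s * lin (v k) x).

Definition uvec (e : cube n) : vec := fun i => \sum_k spin R (e k) * v k i.

(** Each [cosh] is the average of an exponential over a sign; expanding the product gives an average
    over sign vectors, hence over external fields [s * uvec e]. *)
Lemma cosh_weightE s x :
  cosh_weight s x = (2 ^+ n)^-1 * \sum_(e : cube n) expR (s * lin (uvec e) x).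
Proof.
rewrite /cosh_weight; pose F k b := expR (s * (spin R b * lin (v k) x)).
have -> : \prod_k cosh (s * lin (v k) x) = \prod_k (2^-1 * \sum_b F k b).
  apply: eq_bigr => k _; rewrite /cosh /F big_bool /spin /= mulrC.
  by rewrite !mul1r mulN1r mulrN.
rewrite big_split /= prodr_const card_ord exprVn; congr (_ * _).
rewrite (bigA_distr_bigA F); apply: eq_bigr => e _.
by rewrite /F -expR_sum -mulr_sumr lin_sum.
Qed.

Lemma cosh_weight_gt0 s x : 0 < cosh_weight s x.
Proof. by apply: prodr_gt0 => k _; rewrite divr_gt0 // addr_gt0 ?expR_gt0. Qed.

Lemma sum_sign_sqr (y : 'I_n -> R) :
  \sum_(e : cube n) (\sum_k spin R (e k) * y k) ^+ 2 = 2 ^+ n * \sum_k y k ^+ 2.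
Proof.
pose g k b := spin R b * y k; pose p := fun (k : 'I_n) (b : bool) => 1 : R.
have pg j : \sum_b p j b * g j b = 0 by rewrite big_bool /p /g /spin /=; ring.
have := indep_sum_sqr pg.
have -> : \sum_(e : cube n) (\prod_i p i (e i)) * (\sum_j g j (e j)) ^+ 2 =
    \sum_(e : cube n) (\sum_k spin R (e k) * y k) ^+ 2.
  by apply: eq_bigr => e _; rewrite big1 // mul1r.
move=> ->; rewrite mulr_sumr; apply: eq_bigr => j _.
under eq_bigr => e _ do rewrite big1 // mul1r /g exprMn spin_sqr mul1r.
by rewrite sumr_const card_ffun card_bool card_ord -natrX mulr_natl.
Qed.

Variables (w : cube N -> R) (s a c B : R).
Hypothesis w_gt0 : forall x, 0 < w x.
Hypothesis s_ge0 : 0 <= s.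
Hypothesis a_ge0 : 0 <= a.
Hypothesis c_ge0 : 0 <= c.
Hypothesis B_ge0 : 0 <= B.
Hypothesis vB : forall x, \sum_k `|lin (v k) x| <= B.
Hypothesis sB : s * B <= 4^-1.
Hypothesis va : forall y : vec, \sum_k dotp (v k) y ^+ 2 <= a * nrm2 y.

Lemma lin_uvec_le e x : `|lin (uvec e) x| <= B.
Proof.
rewrite lin_sum; apply: le_trans (ler_norm_sum _ _ _) _; apply: le_trans (vB x).
by apply: ler_sum => k _; rewrite normrM normr_spin mul1r.
Qed.

Section FixedField.
Variables (h l : vec).
Hypothesis wc : var_bounded w c.

Let W := tilt w h.
Let Z := \sum_x W x.
Let c0 := av W (lin l).
Let X x := lin l x - c0.
Let V := \sum_x W x * X x ^+ 2.
Let Cv f := \sum_x W x * X x * f x.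

Let W_gt0 x : 0 < W x. Proof. exact: tilt_gt0. Qed.
Let W_ge0 x : 0 <= W x. Proof. exact: ltW. Qed.
Let Z_gt0 : 0 < Z. Proof. exact: cube_sum_gt0. Qed.
Let V_le : V <= c * nrm2 l * Z. Proof. exact: wc. Qed.
Let V_ge0 : 0 <= V.
Proof. by apply: sumr_ge0 => x _; rewrite mulr_ge0 ?sqr_ge0. Qed.
Let CvX : \sum_x W x * X x = 0. Proof. exact: sum_centered. Qed.

Let Cv_lin y : Cv (lin y) = dotp y (fun i => Cv (fun x => spin R (x i))).
Proof.
rewrite /Cv /lin /dotp; under eq_bigr do rewrite mulr_sumr.
rewrite exchange_big; apply: eq_bigr => i _; rewrite mulr_sumr.
by apply: eq_bigr => x _; ring.
Qed.

(* Cauchy-Schwarz turns the quadratic-form bound on the covariance into an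
   operator-norm bound. *)
Let cov_norm : nrm2 (fun i => Cv (fun x => spin R (x i))) <= c ^+ 2 * nrm2 l * Z ^+ 2.
Proof.
set y := fun i => _; set Q := nrm2 y.
have Q0 : 0 <= Q by exact: nrm2_ge0.
have QE : Q = \sum_x W x * X x * (lin y x - av W (lin y)).
  under eq_bigr do rewrite mulrBr.
  rewrite sumrB -mulr_suml CvX mul0r subr0 -/(Cv (lin y)) Cv_lin.
  by apply: eq_bigr => i _; rewrite expr2.
have : Q ^+ 2 <= c ^+ 2 * nrm2 l * Z ^+ 2 * Q.
  rewrite {1}QE; apply: le_trans (cauchy_schwarz_sum _ _ W_ge0) _.
  apply: (@le_trans _ _ ((c * nrm2 l * Z) * (c * Q * Z))).
    apply: ler_pM => //; first by apply: sumr_ge0 => x _; rewrite mulr_ge0 ?sqr_ge0.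
    exact: wc.
  by rewrite le_eqVlt; apply/orP; left; apply/eqP; ring.
have [->|QN] := eqVneq Q 0.
  by move=> _; rewrite !mulr_ge0 ?exprn_ge0 ?nrm2_ge0 // ltW.
by rewrite expr2 ler_pM2r // lt_neqAle eq_sym QN.
Qed.

Let Nr e := \sum_x W x * X x * (expR (s * lin (uvec e) x) - 1).

(** [Nr e] is split into its first-order part [s * Y] and a Taylor remainder [Rr], both controlled
    by Cauchy-Schwarz. The constant 6 is 4 from the cross term plus 2 from [Rr ^ 2]. *)
Let Nr_sqr e : Nr e ^+ 2 <= s ^+ 2 * Cv (lin (uvec e)) ^+ 2 + 6 * (s * B) ^+ 3 * V * Z.
Proof.
pose u x := lin (uvec e) x; pose r x := expR (s * u x) - 1 - s * u x.
have uB x : `|u x| <= B by exact: lin_uvec_le.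
pose Rr := \sum_x W x * X x * r x; set Y := Cv _.
have -> : Nr e = s * Y + Rr.
  rewrite /Y /Cv /Rr mulr_sumr -big_split; apply: eq_bigr => x _.
  rewrite /= /r /u; ring.
have VZ0 : 0 <= V * Z by rewrite mulr_ge0 // ltW.
have sB0 : 0 <= s * B by rewrite mulr_ge0.
have Y2 : Y ^+ 2 <= B ^+ 2 * (V * Z).
  apply: le_trans (cauchy_schwarz_sum _ _ W_ge0) _.
  rewrite mulrCA ler_wpM2l // mulrC /Z mulr_suml; apply: ler_sum => x _.
  by rewrite ler_wpM2l // -real_normK ?num_real // ler_sqr ?nnegrE.
have R2 : Rr ^+ 2 <= (2 * (s * B) ^+ 2) ^+ 2 * (V * Z).
  apply: le_trans (cauchy_schwarz_sum _ _ W_ge0) _.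
  rewrite mulrCA ler_wpM2l // mulrC /Z mulr_suml; apply: ler_sum => x _.
  rewrite ler_wpM2l //.
  have su : `|s * u x| <= s * B by rewrite normrM (ger0_norm s_ge0) ler_wpM2l.
  have /expR_taylor1/andP[r0 r1] : `|s * u x| <= 2^-1 by apply: le_trans su _; have := sB; lra.
  rewrite ler_sqr ?nnegrE // ?mulr_ge0 ?sqr_ge0 //; apply: le_trans r1 _.
  by rewrite ler_pM2l // -real_normK ?num_real // ler_sqr ?nnegrE.
have cross : 2 * (s * Y) * Rr <= 4 * (s * B) ^+ 3 * (V * Z).
  apply: ler_of_sqr; first by rewrite (mulr_ge0 (mulr_ge0 _ _) VZ0) ?exprn_ge0.
  have -> : (2 * (s * Y) * Rr) ^+ 2 = 4 * s ^+ 2 * (Y ^+ 2 * Rr ^+ 2) by ring.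
  have -> : (4 * (s * B) ^+ 3 * (V * Z)) ^+ 2 =
    4 * s ^+ 2 * ((B ^+ 2 * (V * Z)) * ((2 * (s * B) ^+ 2) ^+ 2 * (V * Z))) by ring.
  rewrite ler_wpM2l ?mulr_ge0 ?sqr_ge0 //.
  by apply: ler_pM => //; exact: sqr_ge0.
have R2' : Rr ^+ 2 <= 2 * (s * B) ^+ 3 * (V * Z).
  apply: le_trans R2 _; rewrite ler_wpM2r //.
  have := exprn_ge0 3 sB0; move: sB sB0; set q := s * B => q1 q0 q3.
  rewrite exprMn -!exprM (exprS q 3); nra.
rewrite sqrrD exprMn -mulr_natl; lra.
Qed.

(** Summing over signs removes the cross terms between the [v k]; then [va] is applied to the vector
    of covariances of the spins with [lin l], whose norm [cov_norm] controls. *)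
Let Nr_sum : \sum_e Nr e ^+ 2 <=
  2 ^+ n * (nrm2 l * (s ^+ 2 * a * c ^+ 2 + 6 * (s * B) ^+ 3 * c) * Z ^+ 2).
Proof.
apply: (@le_trans _ _ (s ^+ 2 * \sum_e Cv (lin (uvec e)) ^+ 2 +
    2 ^+ n * (6 * (s * B) ^+ 3 * V * Z))).
  have -> : 2 ^+ n * (6 * (s * B) ^+ 3 * V * Z) = \sum_(e : cube n) 6 * (s * B) ^+ 3 * V * Z.
    by rewrite sumr_const card_ffun card_bool card_ord -natrX mulr_natl.
  by rewrite mulr_sumr -big_split; apply: ler_sum => e _; exact: Nr_sqr.
have -> : \sum_e Cv (lin (uvec e)) ^+ 2 = 2 ^+ n * \sum_k Cv (lin (v k)) ^+ 2.
  rewrite -sum_sign_sqr; apply: eq_bigr => e _; congr (_ ^+ 2).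
  rewrite /Cv; under eq_bigr do rewrite lin_sum mulr_sumr.
  rewrite exchange_big; apply: eq_bigr => k _; rewrite mulr_sumr.
  by apply: eq_bigr => x _; ring.
rewrite mulrCA -mulrDr ler_wpM2l ?exprn_ge0 //.
have H1 : \sum_k Cv (lin (v k)) ^+ 2 <= a * (c ^+ 2 * nrm2 l * Z ^+ 2).
  under eq_bigr do rewrite Cv_lin.
  by apply: le_trans (va _) _; rewrite ler_wpM2l.
have H2 : V * Z <= c * nrm2 l * Z ^+ 2 by rewrite expr2 mulrA ler_wpM2r // ltW.
have sB3 : 0 <= (s * B) ^+ 3 by rewrite exprn_ge0 // mulr_ge0.
have := ler_wpM2l (sqr_ge0 s) H1; have := ler_wpM2l sB3 H2; lra.
Qed.

Let We e := tilt w (fun i => h i + s * uvec e i).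
Let Ze e := \sum_x We e x.

Let WeE e x : We e x = W x * expR (s * lin (uvec e) x).
Proof. by rewrite /We /W /tilt linD linZ expRD mulrA. Qed.

Let Ze_gt0 e : 0 < Ze e. Proof. exact/cube_sum_gt0/tilt_gt0. Qed.

Let Z_le_Ze e : Z <= expR (s * B) * Ze e.
Proof.
rewrite /Ze mulr_sumr; apply: ler_sum => x _; rewrite WeE mulrCA -expRD.
rewrite ler_peMr // -expR0 ler_expR -lerBlDr sub0r -mulrN ler_wpM2l //.
by rewrite lerNl; have := lin_uvec_le e x; rewrite ler_norml => /andP[].
Qed.

(** The second moment about the old mean [c0] is the variance in the shifted field, bounded by
    hypothesis, plus the squared displacement of the mean, which equals [Nr e / Ze e]. *)
Let sum_We_sqr e : \sum_x We e x * X x ^+ 2 <=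
  c * nrm2 l * Ze e + expR (s * B) / Z * Nr e ^+ 2.
Proof.
rewrite (sum_sqr_shift (lin l) c0 (Ze_gt0 e)); apply: lerD; first exact: wc.
set m := av _ _.
have NrE : Nr e = Ze e * (m - c0).
  have := sum_centered (lin l) (Ze_gt0 e); rewrite -/m => cm.
  transitivity (\sum_x We e x * ((lin l x - m) + (m - c0))).
    transitivity (\sum_x We e x * X x - \sum_x W x * X x).
      rewrite -sumrB; apply: eq_bigr => x _; rewrite WeE; ring.
    by rewrite CvX subr0; apply: eq_bigr => x _; rewrite subrKA.
  by under eq_bigr do rewrite mulrDr; rewrite big_split /= cm add0r -mulr_suml.
rewrite NrE exprMn [leRHS]mulrA ler_wpM2r ?sqr_ge0 // mulrAC ler_pdivlMr //.
by have := ler_wpM2l (ltW (Ze_gt0 e)) (Z_le_Ze e); rewrite mulrCA -[Ze e * Ze e]expr2.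
Qed.

Lemma step_field :
  \sum_x tilt (fun x => w x * cosh_weight s x) h x *
     (lin l x - av (tilt (fun x => w x * cosh_weight s x) h) (lin l)) ^+ 2 <=
  (c + (1 + 6 * (s * B)) * (s ^+ 2 * a * c ^+ 2 + 6 * (s * B) ^+ 3 * c)) * nrm2 l *
  \sum_x tilt (fun x => w x * cosh_weight s x) h x.
Proof.
set W' := tilt _ _.
have W'E x : W' x = (2 ^+ n)^-1 * \sum_e We e x.
  rewrite /W' /tilt cosh_weightE mulrAC mulrCA; congr (_ * _).
  by rewrite mulr_sumr; apply: eq_bigr => e _; rewrite WeE.
have pos : 0 < \sum_x W' x.
  by apply/cube_sum_gt0/tilt_gt0 => x; rewrite mulr_gt0 ?cosh_weight_gt0.
(* The variance is at most the second moment about any centre; the old mean [c0] is a common centre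
   for all the mixed fields. *)
apply: (@le_trans _ _ (\sum_x W' x * X x ^+ 2)).
  by rewrite (sum_sqr_shift (lin l) c0 pos) lerDl mulr_ge0 ?sqr_ge0 // ltW.
have -> : \sum_x W' x * X x ^+ 2 = (2 ^+ n)^-1 * \sum_e \sum_x We e x * X x ^+ 2.
  rewrite exchange_big mulr_sumr; apply: eq_bigr => x _.
  by rewrite W'E -mulrA mulr_suml.
have -> : \sum_x W' x = (2 ^+ n)^-1 * \sum_e Ze e.
  by rewrite /Ze exchange_big mulr_sumr; apply: eq_bigr => x _; rewrite W'E.
rewrite mulrCA ler_pM2l ?invr_gt0 ?exprn_gt0 //.
apply: le_trans (ler_sum _ (fun e _ => sum_We_sqr e)) _.
rewrite big_split /= -!mulr_sumr.
set q := s ^+ 2 * a * c ^+ 2 + 6 * (s * B) ^+ 3 * c.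
have -> : (c + (1 + 6 * (s * B)) * q) * nrm2 l * \sum_e Ze e =
    c * nrm2 l * (\sum_e Ze e) + (1 + 6 * (s * B)) * (nrm2 l * q * \sum_e Ze e) by ring.
rewrite lerD2l.
have sB0 : 0 <= s * B by rewrite mulr_ge0.
have q0 : 0 <= q by rewrite addr_ge0 // !mulr_ge0 ?exprn_ge0.
have ZZe : 2 ^+ n * Z <= expR (s * B) * \sum_e Ze e.
  have -> : 2 ^+ n * Z = \sum_(e : cube n) Z.
    by rewrite sumr_const card_ffun card_bool card_ord -natrX mulr_natl.
  by rewrite mulr_sumr; apply: ler_sum.
apply: (@le_trans _ _ (expR (s * B) / Z * (2 ^+ n * (nrm2 l * q * Z ^+ 2)))).
  by rewrite ler_wpM2l ?Nr_sum // divr_ge0 ?expR_ge0 // ltW.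
have -> : expR (s * B) / Z * (2 ^+ n * (nrm2 l * q * Z ^+ 2)) =
    expR (s * B) * (nrm2 l * q) * (2 ^+ n * Z) by field; rewrite gt_eqF.
apply: (@le_trans _ _ (expR (s * B) * (nrm2 l * q) * (expR (s * B) * \sum_e Ze e))).
  by rewrite ler_wpM2l // !mulr_ge0 ?expR_ge0 ?nrm2_ge0.
have -> : expR (s * B) * (nrm2 l * q) * (expR (s * B) * \sum_e Ze e) =
    expR (2 * (s * B)) * (nrm2 l * q * \sum_e Ze e).
  by rewrite mulr_natl mulr2n expRD; ring.
rewrite ler_wpM2r //.
  by rewrite !mulr_ge0 ?nrm2_ge0 // sumr_ge0 // => e _; rewrite ltW.
(* Two factors [exp(s B)] arose from comparing [Z] with the [Ze e]; together they are at most
   [1 + 6 s B] because [s B <= 1/4]. *)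
have sB4 := sB; have /expR_taylor1/andP[_] : `|2 * (s * B)| <= 2^-1.
  by rewrite ger0_norm; lra.
nra.
Qed.

End FixedField.

Lemma var_bounded_step : var_bounded w c ->
  var_bounded (fun x => w x * cosh_weight s x)
    (c + (1 + 6 * (s * B)) * (s ^+ 2 * a * c ^+ 2 + 6 * (s * B) ^+ 3 * c)).
Proof. by move=> wc h l; exact: step_field. Qed.

End Step.
End VarianceBound.

(** * Positive semidefinite forms as sums of squares *)

Section QuadraticForms.
Variables (R : realType) (N : nat).
Local Notation vec := ('I_N -> R).
Implicit Types (M : 'I_N -> 'I_N -> R) (y z : vec).

Definition bform M y z := \sum_i \sum_j M i j * y i * z j.
Definition qform M y := bform M y y.
Definition unitv (i0 : 'I_N) : vec := fun i => (i == i0)%:R.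

Lemma bform_sym M y z : (forall i j, M i j = M j i) -> bform M y z = bform M z y.
Proof.
move=> Msym; rewrite /bform exchange_big; apply: eq_bigr => i _.
by apply: eq_bigr => j _; rewrite Msym mulrAC.
Qed.

Lemma qformD M y z t : (forall i j, M i j = M j i) ->
  qform M (fun i => y i + t * z i) =
  qform M y + 2 * t * bform M z y + t ^+ 2 * qform M z.
Proof.
move=> Msym; have -> : 2 * t * bform M z y = t * bform M z y + t * bform M y z.
  by rewrite (bform_sym y z) //; ring.
rewrite /qform /bform !mulr_sumr -!big_split; apply: eq_bigr => i _.
rewrite !mulr_sumr -!big_split; apply: eq_bigr => j _ /=; ring.
Qed.

Lemma bform_unitl M i0 y : bform M (unitv i0) y = dotp (M i0) y.
Proof.
rewrite /bform (bigD1 i0) //= [X in _ + X]big1 ?addr0 => [|i /negbTE i0i].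
  by apply: eq_bigr => j _; rewrite /unitv eqxx mulr1.
by rewrite big1 // => j _; rewrite /unitv i0i mulr0 mul0r.
Qed.

Lemma dotp_unitr (l : vec) i0 : dotp l (unitv i0) = l i0.
Proof.
rewrite /dotp (bigD1 i0) //= big1 ?addr0 => [|i /negbTE i0i].
  by rewrite /unitv eqxx mulr1.
by rewrite /unitv i0i mulr0.
Qed.

Lemma qform_sub_rank1 M (l : vec) y :
  qform (fun i j => M i j - l i * l j) y = qform M y - dotp l y ^+ 2.
Proof.
rewrite /qform /bform /dotp expr2 mulr_suml -sumrB; apply: eq_bigr => i _.
rewrite mulr_sumr -sumrB; apply: eq_bigr => j _; ring.
Qed.

(** One Cholesky step, with [l] the row [i0] divided by the root of the pivot. Cauchy-Schwarz for
    the form [M] keeps the remainder nonnegative, and the last clause protects the rows cleared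
    earlier. *)
Lemma psd_eliminate M (i0 : 'I_N) : (forall i j, M i j = M j i) ->
  (forall y, 0 <= qform M y) ->
  exists l : vec, [/\ forall y, 0 <= qform (fun i j => M i j - l i * l j) y,
    forall j, M i0 j = l i0 * l j & forall i, M i0 i = 0 -> l i = 0].
Proof.
move=> Msym Mpsd; pose d := M i0 i0.
have dE : qform M (unitv i0) = d by rewrite /qform bform_unitl dotp_unitr.
have d0 : 0 <= d by rewrite -dE.
have row y : dotp (M i0) y ^+ 2 <= qform M y * d.
  apply: discriminant_le0 => // t.
  by have := Mpsd (fun i => y i + t * unitv i0 i); rewrite qformD // bform_unitl dE.
have lE y : dotp (fun j => M i0 j / Num.sqrt d) y = dotp (M i0) y / Num.sqrt d.
  by rewrite /dotp mulr_suml; apply: eq_bigr => i _; rewrite mulrAC.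
exists (fun j => M i0 j / Num.sqrt d); split.
- move=> y; rewrite qform_sub_rank1 lE expr_div_n sqr_sqrtr //.
  have [d_eq0|dN] := eqVneq d 0; first by rewrite d_eq0 invr0 mulr0 subr0.
  by rewrite subr_ge0 ler_pdivrMr // lt_neqAle eq_sym dN.
(* With a zero pivot, division by zero makes [l] vanish, and [row] shows that the row of [M]
   vanishes as well. *)
- move=> j; have [d_eq0|dN] := eqVneq d 0.
    have := row (unitv j); rewrite d_eq0 mulr0 dotp_unitr sqrtr0 invr0 !mulr0 => h.
    by apply/eqP; rewrite -sqrf_eq0 eq_le h sqr_ge0.
  rewrite mulrACA -invfM -expr2 sqr_sqrtr // -/d; field; exact: dN.
- by move=> i ->; rewrite mul0r.
Qed.

(** Elimination of the rows in order: after [m] steps the first [m] rows of the remainder are zero,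
    so nothing is left after [N] steps. *)
Lemma psd_sum_squares M : (forall i j, M i j = M j i) -> (forall y, 0 <= qform M y) ->
  exists v : 'I_N -> vec, forall y, qform M y = \sum_k dotp (v k) y ^+ 2.
Proof.
move=> Msym Mpsd.
have H m : (m <= N)%N -> exists v : nat -> vec,
   let M' i j := M i j - \sum_(k < m) v k i * v k j in
   (forall y, 0 <= qform M' y) /\ (forall i j : 'I_N, (i < m)%N -> M' i j = 0).
  elim: m => [|m IH] mN.
    exists (fun _ _ => 0); split=> // y; rewrite (_ : (fun i j => _) = M) //.
    by apply/funext => i; apply/funext => j; rewrite big_ord0 subr0.
  have [v [psd rows]] := IH (ltnW mN); pose i0 := Ordinal mN.
  pose M' i j := M i j - \sum_(k < m) v k i * v k j.
  have M'sym i j : M' i j = M' j i.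
    by rewrite /M' Msym; congr (_ - _); apply: eq_bigr => k _; rewrite mulrC.
  have [l [lpsd lrow l0]] := psd_eliminate i0 M'sym psd.
  exists (fun k => if k == m then l else v k).
  have E : (fun i j => M i j - \sum_(k < m.+1) (if k == m :> nat then l else v k) i *
      (if k == m :> nat then l else v k) j) = fun i j => M' i j - l i * l j.
    apply/funext => i; apply/funext => j; rewrite big_ord_recr /= eqxx opprD addrA.
    congr (_ - _ - _); apply: eq_bigr => k _; by rewrite ltn_eqF.
  rewrite /= E; split => // i j; have /= := congr1 (fun f => f i j) E => ->.
  rewrite ltnS leq_eqVlt => /orP[/eqP im|im].
    have -> : i = i0 by exact: val_inj.
    by rewrite lrow subrr.
  by rewrite /M' rows // l0 ?mul0r ?subrr // -/(M' _ _) M'sym /M' rows.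
have [v [_ rows]] := H N (leqnn N).
exists (fun k => v k) => y; rewrite /qform /bform.
have ME i j : M i j = \sum_(k < N) v k i * v k j.
  by apply/eqP; rewrite -subr_eq0 rows.
under eq_bigr => i _ do under eq_bigr => j _ do rewrite ME mulr_suml mulr_suml.
under eq_bigr => i _ do rewrite exchange_big.
rewrite exchange_big; apply: eq_bigr => k _; rewrite /dotp expr2 mulr_suml.
apply: eq_bigr => i _; rewrite mulr_sumr; apply: eq_bigr => j _; ring.
Qed.

End QuadraticForms.

(** * The variance bound for quadratic interactions of small norm *)

Section HighTemperature.
Variables (R : realType) (N : nat).
Local Notation cube n := {ffun 'I_n -> bool}.
Local Notation vec := ('I_N -> R).

Lemma var_bounded_le (w : cube N -> R) c c' : (forall x, 0 < w x) -> c <= c' ->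
  var_bounded w c -> var_bounded w c'.
Proof.
move=> w0 cc' wc h l; apply: le_trans (wc h l) _.
by rewrite ler_wpM2r ?ler_wpM2r ?nrm2_ge0 // ltW // cube_sum_gt0 //; exact: tilt_gt0.
Qed.

(** A perturbation argument of Holley-Stroock type: a variance is the least second moment over all
    centres, so the mean under [w] may serve as centre for [w']. *)
Lemma var_bounded_comparable (w w' : cube N -> R) c K : (forall x, 0 < w x) ->
  0 <= K -> 0 <= c -> (forall x, w x <= w' x <= K * w x) ->
  var_bounded w c -> var_bounded w' (K * c).
Proof.
move=> w0 K0 c0 ww' wc h l.
have w'0 x : 0 < w' x by have /andP[+ _] := ww' x; exact: lt_le_trans.
have pos' := cube_sum_gt0 (tilt_gt0 h w'0).
set m := av (tilt w h) (lin l).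
apply: (@le_trans _ _ (\sum_x tilt w' h x * (lin l x - m) ^+ 2)).
  by rewrite [leRHS](sum_sqr_shift (lin l) m pos') lerDl mulr_ge0 ?sqr_ge0 // ltW.
apply: (@le_trans _ _ (K * \sum_x tilt w h x * (lin l x - m) ^+ 2)).
  rewrite mulr_sumr; apply: ler_sum => x _; rewrite [leRHS]mulrA ler_wpM2r ?sqr_ge0 //.
  by rewrite /tilt [leRHS]mulrA ler_wpM2r ?expR_ge0 //; case/andP: (ww' x).
rewrite -!mulrA ler_wpM2l //; apply: le_trans (wc h l) _.
rewrite -mulrA ler_wpM2l // ler_wpM2l ?nrm2_ge0 //; apply: ler_sum => x _.
by rewrite /tilt ler_wpM2r ?expR_ge0 //; case/andP: (ww' x).
Qed.

(** Each step adds at most [1/m^2] as long as the constant stays below 2, and it does so for the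
    whole of the [m^2] steps. The lower bound on [m] yields [B/m <= 1/24] and [B^3/m <= 1/48]. *)
Lemma var_bounded_iter n (v : 'I_n -> vec) (B : R) (m : nat) : (0 < m)%N -> 0 <= B ->
  (forall x, \sum_k `|lin (v k) x| <= B) ->
  (forall y, \sum_k dotp (v k) y ^+ 2 <= 8^-1 * nrm2 y) ->
  24 * B + 48 * B ^+ 3 <= m%:R ->
  forall j, (j <= m ^ 2)%N ->
    var_bounded (fun x => cosh_weight v m%:R^-1 x ^+ j) (1 + j%:R / m%:R ^+ 2).
Proof.
move=> m0 B0 vB va mB; set s := m%:R^-1.
have mp : 0 < m%:R :> R by rewrite ltr0n.
have s0 : 0 <= s by rewrite invr_ge0.
have B3 : 0 <= B ^+ 3 by rewrite exprn_ge0.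
have sB1 : s * B <= 24^-1.
  by rewrite /s mulrC ler_pdivrMr //; lra.
have sB3 : s * B ^+ 3 <= 48^-1.
  by rewrite /s mulrC ler_pdivrMr //; lra.
have sB0 : 0 <= s * B by rewrite mulr_ge0.
have E0 x : 0 < cosh_weight v s x by exact: cosh_weight_gt0.
elim=> [|j IH] jm.
  rewrite mul0r addr0; have := @var_bounded_product R N.
  by congr var_bounded; apply/funext => x; rewrite expr0.
have := @var_bounded_step R N n v (fun x => cosh_weight v s x ^+ j) s 8^-1
  (1 + j%:R / m%:R ^+ 2) B.
set c := 1 + j%:R / _ => step.
have c1 : 1 <= c by rewrite lerDl divr_ge0 // exprn_ge0.
have c2 : c <= 2.
  suff : j%:R / m%:R ^+ 2 <= 1 :> R by rewrite /c; lra.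
  by rewrite ler_pdivrMr ?exprn_gt0 // mul1r -natrX ler_nat ltnW.
have {}step := step (fun x => exprn_gt0 j (E0 x)) s0 _ _ B0 vB _ va (IH (ltnW jm)).
rewrite (_ : (fun x => cosh_weight v s x ^+ j.+1) =
             fun x => cosh_weight v s x ^+ j * cosh_weight v s x); last first.
  by apply/funext => x; rewrite exprSr.
apply: (var_bounded_le _ _ (step _ _ _)) => [x||||]; [|  |lra|lra|lra].
  by rewrite mulr_gt0 ?exprn_gt0.
have -> : 1 + j.+1%:R / m%:R ^+ 2 = c + s ^+ 2.
  by rewrite /c /s exprVn -natr1; ring.
rewrite lerD2l.
(* The prefactor is at most [1 + 6/24 = 5/4]. With [c <= 2] the bracket is at most
   [s^2 (4/8 + 12/48) = 3 s^2 / 4], and [15/16 < 1]. *)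
apply: (@le_trans _ _ (5 / 4 * (s ^+ 2 * (3 / 4)))); last by have := sqr_ge0 s; lra.
have s2 := sqr_ge0 s.
apply: ler_pM; first by lra.
- by rewrite addr_ge0 // !mulr_ge0 ?exprn_ge0 //; lra.
- by lra.
have -> : s ^+ 2 * 8^-1 * c ^+ 2 + 6 * (s * B) ^+ 3 * c =
  s ^+ 2 * (8^-1 * c ^+ 2 + 6 * (s * B ^+ 3) * c) by ring.
rewrite ler_wpM2l //; have sB3' : 0 <= s * B ^+ 3 by rewrite mulr_ge0.
nra.
Qed.

(* One step of size [m^-1] changes the weight by a factor that agrees with a
   Gaussian smoothing to second order, so [m ^ 2] steps approximate the exponential
   of the full quadratic form. *)
Lemma cosh_weight_pow n (v : 'I_n -> vec) (B : R) (m : nat) x : (0 < m)%N -> 0 <= B ->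
  \sum_k `|lin (v k) x| <= B -> B ^+ 2 <= m%:R ->
  cosh_weight v m%:R^-1 x ^+ (m ^ 2) <= expR (2^-1 * \sum_k lin (v k) x ^+ 2)
    <= 3 / 2 * cosh_weight v m%:R^-1 x ^+ (m ^ 2).
Proof.
move=> m0 B0 vB mB; set s := m%:R^-1; set L := fun k => lin (v k) x.
have mp : 0 < m%:R :> R by rewrite ltr0n.
have s0 : 0 <= s by rewrite invr_ge0.
have sm : s * m%:R = 1 by rewrite /s mulVf // gt_eqF.
have E0 : 0 <= cosh_weight v s x by rewrite ltW // cosh_weight_gt0.
have powE (f : 'I_n -> R) : (\prod_k expR (f k)) ^+ (m ^ 2) =
    expR (\sum_k m%:R ^+ 2 * f k).
  by rewrite -expR_sum -expRM_natl natrX mulr_sumr.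
apply/andP; split.
  apply: (@le_trans _ _ ((\prod_k expR ((s * L k) ^+ 2 / 2)) ^+ (m ^ 2))).
    rewrite ler_pXn2r ?nnegrE ?expn_gt0 ?m0 //; last by apply: prodr_ge0 => k _; exact: expR_ge0.
    apply: ler_prod => k _; rewrite cosh_upper andbT.
    by rewrite divr_ge0 // addr_ge0 ?expR_ge0.
  have /= -> := powE (fun k => (s * L k) ^+ 2 / 2).
  rewrite ler_expR mulr_sumr; apply: ler_sum => k _.
  have -> : m%:R ^+ 2 * ((s * L k) ^+ 2 / 2) = (s * m%:R) ^+ 2 * (2^-1 * L k ^+ 2) by ring.
  by rewrite sm expr1n mul1r.
have : (\prod_k expR ((s * L k) ^+ 2 / 2 - (s * L k) ^+ 4 / 4)) ^+ (m ^ 2) <=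
    cosh_weight v s x ^+ (m ^ 2).
  rewrite ler_pXn2r ?nnegrE ?expn_gt0 ?m0 //; last by apply: prodr_ge0 => k _; exact: expR_ge0.
  by apply: ler_prod => k _; rewrite cosh_upper_sharp expR_ge0.
have /= -> := powE (fun k => (s * L k) ^+ 2 / 2 - (s * L k) ^+ 4 / 4).
have LB k : `|L k| <= B.
  apply: le_trans vB; rewrite (bigD1 k) //= lerDl; exact: sumr_ge0.
(* The quartic errors of the [m^2] factors add up to at most [(s B^2)^2 / 4 <= 1/4], using
   [B^2 <= m]; finally [exp(1/4) <= 3/2]. *)
have err : \sum_k s ^+ 2 * L k ^+ 4 / 4 <= 4^-1.
  apply: (@le_trans _ _ (4^-1 * s ^+ 2 * (B ^+ 3 * \sum_k `|L k|))).
    rewrite !mulr_sumr; apply: ler_sum => k _.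
    have -> : s ^+ 2 * L k ^+ 4 / 4 = 4^-1 * s ^+ 2 * (`|L k| ^+ 3 * `|L k|).
      by rewrite -exprSr -[4%N]/(2 * 2)%N !exprM real_normK ?num_real //; ring.
    by rewrite ler_wpM2l ?mulr_ge0 // ler_wpM2r // lerXn2r ?nnegrE.
  apply: (@le_trans _ _ (4^-1 * (s * B ^+ 2) ^+ 2)).
    have -> : 4^-1 * (s * B ^+ 2) ^+ 2 = 4^-1 * s ^+ 2 * (B ^+ 3 * B) by ring.
    by rewrite ler_wpM2l ?mulr_ge0 ?sqr_ge0 // ler_wpM2l ?exprn_ge0.
  have : s * B ^+ 2 <= 1 by rewrite /s mulrC ler_pdivrMr // mul1r.
  have : 0 <= s * B ^+ 2 by rewrite mulr_ge0 ?sqr_ge0 ?invr_ge0.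
  nra.
move=> H; apply: (@le_trans _ _ (expR 4^-1 * cosh_weight v s x ^+ (m ^ 2))); last first.
  rewrite ler_wpM2r ?exprn_ge0 //; have /expR_taylor1/andP[_] : `|4^-1 : R| <= 2^-1.
    by rewrite ger0_norm; lra.
  lra.
apply: le_trans (ler_wpM2l (expR_ge0 _) H); rewrite -expRD ler_expR.
rewrite -lerBlDr; apply: le_trans err; rewrite mulr_sumr -sumrB; apply: ler_sum => k _.
have -> : m%:R ^+ 2 * ((s * L k) ^+ 2 / 2 - (s * L k) ^+ 4 / 4) =
  (s * m%:R) ^+ 2 * (2^-1 * L k ^+ 2 - s ^+ 2 * L k ^+ 4 / 4) by ring.
by rewrite sm expr1n mul1r opprB addrC subrK.
Qed.

(** [B] is finite because the cube is, so [m] can be taken large enough for both previous lemmas.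
    The full [m^2] steps give the constant 2, and the comparison of weights costs a factor [3/2]. *)
Lemma var_bounded_quadratic n (v : 'I_n -> vec) :
  (forall y, \sum_k dotp (v k) y ^+ 2 <= 8^-1 * nrm2 y) ->
  var_bounded (fun x => expR (2^-1 * \sum_k lin (v k) x ^+ 2)) 3.
Proof.
move=> va; pose B : R := \sum_(x : cube N) \sum_k `|lin (v k) x|.
have B0 : 0 <= B by apply: sumr_ge0 => x _; apply: sumr_ge0.
have vB x : \sum_k `|lin (v k) x| <= B.
  by rewrite /B (bigD1 x) //= lerDl; apply: sumr_ge0 => y _; apply: sumr_ge0.
have B3 := exprn_ge0 3 B0; have B2 := exprn_ge0 2 B0.
pose m := (Num.truncn (24 * B + 48 * B ^+ 3 + B ^+ 2)).+1.
have mB : 24 * B + 48 * B ^+ 3 + B ^+ 2 <= m%:R by exact/ltW/truncnS_gt.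
have iter := @var_bounded_iter _ v B m isT B0 vB va _ _ (leqnn _).
rewrite natrX divff ?expf_neq0 ?pnatr_eq0 // in iter.
have -> : 3 = 3 / 2 * 2 :> R by field.
apply: (@var_bounded_comparable _ _ _ _ _ _ _ _ (iter _)) => [x|||x|]; [|lra|lra| |lra].
  by rewrite exprn_gt0 ?cosh_weight_gt0.
by apply: (cosh_weight_pow _ B0 (vB x)) => //; lra.
Qed.

End HighTemperature.

(** * From variances to moments *)

Section Subgaussian.
Variable R : realType.

Definition laplace (T : finType) (a b : T -> R) (s : R) := \sum_x a x * expR (s * b x).

Lemma is_derive_laplace (T : finType) (a b : T -> R) (s : R) :
  is_derive s 1 (laplace a b) (laplace (fun x => a x * b x) b s).
Proof.
have -> : laplace a b =
    \sum_(i < #|T|) (fun s : R => a (enum_val i) * expR (s * b (enum_val i))).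
  by apply/funext => t; rewrite /laplace fct_sumE (reindex_onto _ _ (fun i _ => enum_rankK i)) /=;
     apply: eq_bigl => i; rewrite enum_valK eqxx.
have -> : laplace (fun x => a x * b x) b s =
    \sum_(i < #|T|) (a (enum_val i) * b (enum_val i) * expR (s * b (enum_val i))).
  by rewrite /laplace (reindex_onto _ _ (fun i _ => enum_rankK i)) /=;
     apply: eq_bigl => i; rewrite enum_valK eqxx.
apply: is_derive_sum => i; apply: is_derive_eq; rewrite /GRing.scale /=; ring.
Qed.

(** The hypothesis says that the second derivative of [log Z] is at most [K]. Hence [m], the
    derivative of [log Z], satisfies [m s - m (- s) <= 2 K s], and integrating once more bounds
    [log (Z 1 * Z (-1))]. *)
Lemma laplace_sym_le (T : finType) (a b : T -> R) (K : R) :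
  (forall x, 0 < a x) -> (0 < #|T|)%N ->
  (forall s, laplace (fun x => a x * b x ^+ 2) b s * laplace a b s -
      laplace (fun x => a x * b x) b s ^+ 2 <= K * laplace a b s ^+ 2) ->
  laplace a b 1 * laplace a b (-1) <= expR K * laplace a b 0 ^+ 2.
Proof.
move=> a0 T0 HK.
pose Z := laplace a b; pose Z1 := laplace (fun x => a x * b x) b.
pose Z2 := laplace (fun x => a x * b x ^+ 2) b.
have Zp s : 0 < Z s.
  have /card_gt0P[x0 _] := T0; rewrite /Z /laplace (bigD1 x0) //= ltr_pwDl //.
    by rewrite mulr_gt0 ?expR_gt0.
  by apply: sumr_ge0 => x _; rewrite ltW // mulr_gt0 ?expR_gt0.
have Zn s : Z s != 0 by rewrite gt_eqF.
have dZ s : is_derive s (1 : R) Z (Z1 s) by exact: is_derive_laplace.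
have dZ1 s : is_derive s (1 : R) Z1 (Z2 s).
  have := is_derive_laplace (fun x => a x * b x) b s; congr is_derive.
  by apply: eq_bigr => x _; rewrite expr2 mulrA.
have dN s : is_derive s (1 : R) (fun s : R => - s) (-1) by apply: is_derive_eq.
have dZN s : is_derive s (1 : R) (fun s => Z (- s)) (- Z1 (- s)).
  by have := @is_derive1_comp _ Z -%R s _ _ (dZ (- s)) (dN s); rewrite /comp mulrN1.
have dZ1N s : is_derive s (1 : R) (fun s => Z1 (- s)) (- Z2 (- s)).
  by have := @is_derive1_comp _ Z1 -%R s _ _ (dZ1 (- s)) (dN s); rewrite /comp mulrN1.
pose m s := Z1 s / Z s.
have dm s : is_derive s (1 : R) m ((Z2 s * Z s - Z1 s ^+ 2) / Z s ^+ 2).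
  have dV : is_derive s (1 : R) (fun s => (Z s)^-1) (- (Z s) ^- 2 *: Z1 s).
    exact: is_deriveV.
  have := is_deriveM (dZ1 s) dV; rewrite /GRing.scale /=.
  by move=> H; apply: (is_derive_eq H); field; exact: Zn.
have dmN s : is_derive s (1 : R) (fun s => m (- s))
    (- ((Z2 (- s) * Z (- s) - Z1 (- s) ^+ 2) / Z (- s) ^+ 2)).
  by have := @is_derive1_comp _ m -%R s _ _ (dm (- s)) (dN s); rewrite /comp mulrN1.
have mK s : (Z2 s * Z s - Z1 s ^+ 2) / Z s ^+ 2 <= K by rewrite ler_pdivrMr ?exprn_gt0.
have step1 s : 0 <= s -> m s - m (- s) <= 2 * K * s.
  move=> s0; have := @derive_ge0_nondecreasing _ (fun s => 2 * K * s - m s + m (- s))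
    (fun s => 2 * K - (Z2 s * Z s - Z1 s ^+ 2) / Z s ^+ 2 +
       - ((Z2 (- s) * Z (- s) - Z1 (- s) ^+ 2) / Z (- s) ^+ 2)) s.
  rewrite /= oppr0 mulr0 sub0r addNr => H.
  suff : 0 <= 2 * K * s - m s + m (- s) by lra.
  apply: H => // [x|x _]; last by have := mK x; have := mK (- x); lra.
  by apply: is_derive_eq; rewrite /GRing.scale /=; ring.
(* Logarithms are avoided: [exp(- K s^2) Z(s) Z(-s)] is shown to be nonincreasing on [s >= 0]. *)
have := @derive_ge0_nondecreasing _
  (fun s => - (expR (- (K * s ^+ 2)) * (Z s * Z (- s))))
  (fun s => expR (- (K * s ^+ 2)) * (Z s * Z (- s)) * (2 * K * s - (m s - m (- s)))) 1.
rewrite expr0n mulr0 oppr0 expR0 mul1r expr1n mulr1 -expr2 => H.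
have {H} : expR (- K) * (Z 1 * Z (-1)) <= Z 0 ^+ 2.
  rewrite -lerN2; apply: H => [x|x x0|]; last exact: ler01.
    by rewrite /m; apply: is_derive_eq; rewrite /GRing.scale /=; field; rewrite !Zn.
  rewrite mulr_ge0 // ?mulr_ge0 ?expR_ge0 ?subr_ge0 ?step1 // ltW //.
by rewrite expRN mulrC ler_pdivrMr ?expR_gt0 // [leRHS]mulrC.
Qed.

Variable N : nat.
Local Notation cube n := {ffun 'I_n -> bool}.
Local Notation vec := ('I_N -> R).

(** Along the path, multiplying by [exp(s * lin l)] only moves the field from [h] to [h + s l],
    where the variance bound still holds. *)
Lemma var_bounded_subgaussian (w : cube N -> R) (c : R) (h l : vec) :
  (forall x, 0 < w x) -> var_bounded w c ->
  (\sum_x tilt w h x * expR (lin l x)) * (\sum_x tilt w h x * expR (- lin l x)) <=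
  expR (c * nrm2 l) * (\sum_x tilt w h x) ^+ 2.
Proof.
move=> w0 wc; have a0 := tilt_gt0 h w0.
have <- : laplace (tilt w h) (lin l) 1 = \sum_x tilt w h x * expR (lin l x).
  by apply: eq_bigr => x _; rewrite mul1r.
have <- : laplace (tilt w h) (lin l) (-1) = \sum_x tilt w h x * expR (- lin l x).
  by apply: eq_bigr => x _; rewrite mulN1r.
have <- : laplace (tilt w h) (lin l) 0 = \sum_x tilt w h x.
  by apply: eq_bigr => x _; rewrite mul0r expR0 mulr1.
apply: laplace_sym_le => //; first by rewrite card_ffun card_bool expn_gt0.
move=> s; set h' := fun i => h i + s * l i.
have tE x : tilt w h x * expR (s * lin l x) = tilt w h' x.
  by rewrite /h' /tilt linD linZ expRD mulrA.
have E f : laplace (fun x => tilt w h x * f x) (lin l) s = \sum_x tilt w h' x * f x.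
  by apply: eq_bigr => x _; rewrite mulrAC tE.
have E1 : laplace (tilt w h) (lin l) s = \sum_x tilt w h' x by apply: eq_bigr.
have pos := cube_sum_gt0 (tilt_gt0 h' w0).
rewrite !E E1; have := wc h' l; have := sum_sqr_shift (lin l) 0 pos.
set Z := \sum_x tilt w h' x; rewrite -/Z.
under eq_bigr do rewrite subr0; rewrite subr0 => -> H.
have := ler_wpM2r (ltW pos) H; rewrite -/Z.
have -> : \sum_x tilt w h' x * lin l x = Z * av (tilt w h') (lin l).
  by rewrite /av mulrC divfK // gt_eqF.
lra.
Qed.

Lemma fact_le_exp n : (n`! <= n ^ n)%N.
Proof.
elim: n => // n IH; rewrite factS expnS leq_mul2l /=.
by apply: leq_trans IH _; case: n => // n; rewrite leq_exp2r.
Qed.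

(** A power is bounded by the exponential at scale [r = sqrt k], which balances the factorial
    against [exp(c r^2)]. Then [2 (2k)! <= 2^k (2k)^(2k) = (8k)^k k^k]. *)
Lemma subgaussian_moment (w : cube N -> R) (c : R) (h t : vec) (k : nat) :
  (forall x, 0 < w x) -> var_bounded w c -> nrm2 t = 1 -> (0 < k)%N ->
  \sum_x \sum_y (lin t x - lin t y) ^+ (2 * k) * tilt w h x * tilt w h y <=
  (8 * expR c * k%:R) ^+ k * (\sum_x tilt w h x) ^+ 2.
Proof.
move=> w0 wc t1 k0; set W := tilt w h; set Z := \sum_x W x.
have W0 x : 0 <= W x by exact/ltW/tilt_gt0.
have kp : 0 < k%:R :> R by rewrite ltr0n.
set r := Num.sqrt (k%:R : R).
have r2 : r ^+ 2 = k%:R by rewrite sqr_sqrtr // ltW.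
have r0 : 0 < r by rewrite sqrtr_gt0.
pose S := \sum_x W x * expR (lin (fun i => r * t i) x).
pose S' := \sum_x W x * expR (- lin (fun i => r * t i) x).
have SS' : S * S' <= expR c ^+ k * Z ^+ 2.
  apply: le_trans (var_bounded_subgaussian _ _ w0 wc) _.
  rewrite ler_wpM2r ?sqr_ge0 // -expRM_natl ler_expR /nrm2.
  under eq_bigr do rewrite exprMn r2.
  by rewrite -mulr_sumr -/(nrm2 t) t1 mulr1 mulrC.
have key u : u ^+ (2 * k) <=
    (2 * k)`!%:R / k%:R ^+ k * (expR (r * u) + expR (- (r * u))).
  rewrite mulrAC ler_pdivlMr ?exprn_gt0 //.
  have -> : u ^+ (2 * k) * k%:R ^+ k = `|r * u| ^+ (2 * k).
    by rewrite -r2 -exprM -exprMn mulrC !exprM real_normK ?num_real.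
  apply: le_trans (pow_le_fact_exp _ (normr_ge0 _)) _.
  rewrite ler_wpM2l //; have [u0|/ltW u0] := leP 0 (r * u).
    by rewrite ger0_norm // lerDl expR_ge0.
  by rewrite ler0_norm // lerDr expR_ge0.
apply: (@le_trans _ _ ((2 * k)`!%:R / k%:R ^+ k * (2 * (S * S')))).
  (* For two independent replicas both signs of the exponent contribute the same product [S * S'],
     by exchanging the replicas. *)
  have -> : 2 * (S * S') = \sum_x \sum_y (expR (r * (lin t x - lin t y)) +
      expR (- (r * (lin t x - lin t y)))) * W x * W y.
    have A : S * S' = \sum_x \sum_y expR (r * (lin t x - lin t y)) * W x * W y.
      rewrite /S /S' mulr_suml; apply: eq_bigr => x _; rewrite mulr_sumr.
      apply: eq_bigr => y _; rewrite !linZ mulrBr expRD; ring.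
    have A' : S * S' = \sum_x \sum_y expR (- (r * (lin t x - lin t y))) * W x * W y.
      rewrite mulrC /S /S' mulr_suml; apply: eq_bigr => x _; rewrite mulr_sumr.
      apply: eq_bigr => y _; rewrite !linZ mulrBr opprB expRD; ring.
    rewrite mulr_natl mulr2n {1}A A' -big_split; apply: eq_bigr => x _.
    by rewrite -big_split; apply: eq_bigr => y _; rewrite !mulrDl.
  rewrite mulr_sumr; apply: ler_sum => x _; rewrite mulr_sumr; apply: ler_sum => y _.
  rewrite -[leLHS]mulrA -[X in _ <= _ * X]mulrA [leRHS]mulrA.
  by rewrite ler_wpM2r // mulr_ge0.
have fact : (2 * k)`!%:R * 2 <= (8 * k%:R) ^+ k * k%:R ^+ k :> R.
  rewrite -exprMn -mulrA -expr2.
  have -> : (8 * k%:R ^+ 2) ^+ k = ((2 * k) ^ (2 * k))%:R * 2 ^+ k :> R.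
    by rewrite natrX natrM exprM -exprMn; congr (_ ^+ _); ring.
  apply: ler_pM => //; first by rewrite ler_nat fact_le_exp.
  by rewrite -[leLHS]expr1 ler_eXn2l // ltr1n.
have SS0 : 0 <= S * S'.
  by rewrite mulr_ge0 // sumr_ge0 // => x _; rewrite mulr_ge0 ?expR_ge0.
have -> : (8 * expR c * k%:R) ^+ k * Z ^+ 2 = (8 * k%:R) ^+ k * (expR c ^+ k * Z ^+ 2).
  by rewrite mulrA -exprMn; congr (_ ^+ _ * _); ring.
apply: le_trans (ler_wpM2l _ SS'); last by rewrite exprn_ge0 // mulr_ge0 // ltW.
rewrite [leLHS]mulrA ler_wpM2r // mulrAC ler_pdivrMr ?exprn_gt0 //.
Qed.

End Subgaussian.

(** * Operator norms and the lattice net *)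

Section Net.
Variables (R : realType) (N : nat).
Local Notation vec := ('I_N -> R).
Local Notation radius := (25 * N)%N.

(** Integer vectors in sign and magnitude form; zero has two codes, so sums over [lattice]
    overcount. The range suffices for squared norm at most [25 N], as an integer is at most its
    square. *)
Definition lattice := {ffun 'I_N -> bool * 'I_radius.+1}.
Definition lval (z : lattice) : vec := fun i => spin R (z i).1 * ((z i).2 : nat)%:R.

Lemma lval_sqr (z : lattice) i : lval z i ^+ 2 = ((z i).2 : nat)%:R ^+ 2.
Proof. by rewrite exprMn spin_sqr mul1r. Qed.

Lemma nrm2Z c (y : vec) : nrm2 (fun i => c * y i) = c ^+ 2 * nrm2 y.
Proof. by rewrite /nrm2 mulr_sumr; apply: eq_bigr => i _; rewrite exprMn. Qed.

Lemma qformZ M c (y : vec) : qform M (fun i => c * y i) = c ^+ 2 * qform M y.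
Proof.
rewrite /qform /bform mulr_sumr; apply: eq_bigr => i _; rewrite mulr_sumr.
by apply: eq_bigr => j _; ring.
Qed.

(** Rounding each coordinate towards zero cannot increase the norm and moves the coordinate by less
    than 1. *)
Lemma lattice_round (y : vec) : nrm2 y <= 25 * N%:R ->
  exists z : lattice, nrm2 (lval z) <= nrm2 y /\ nrm2 (fun i => y i - lval z i) <= N%:R.
Proof.
move=> yr; pose n i := Num.truncn `|y i|.
have ny i : (n i)%:R <= `|y i| by rewrite truncn_le.
have yn i : `|y i| < (n i).+1%:R by exact: truncnS_gt.
have nr i : (n i < radius.+1)%N.
  rewrite ltnS -(ler_nat R) natrM; apply: le_trans yr.
  apply: (@le_trans _ _ ((n i)%:R ^+ 2)).
    by rewrite -natrX ler_nat; case: (n i) => // m; rewrite leq_pmulr.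
  apply: (@le_trans _ _ (y i ^+ 2)).
    by rewrite -[leRHS]real_normK ?num_real // ler_sqr ?nnegrE.
  by rewrite /nrm2 (bigD1 i) //= lerDl; apply: sumr_ge0 => j _; exact: sqr_ge0.
exists [ffun i => (0 <= y i, Ordinal (nr i))]; split.
  apply: ler_sum => i _; rewrite lval_sqr ffunE /=.
  by rewrite -[leRHS]real_normK ?num_real // ler_sqr ?nnegrE.
apply: (@le_trans _ _ (\sum_(i < N) 1)); last by rewrite sumr_const card_ord.
apply: ler_sum => i _; rewrite /lval ffunE /=.
have {1}-> : y i = spin R (0 <= y i) * `|y i|.
  have [y0|y0] := leP 0 (y i); first by rewrite /spin mul1r ger0_norm.
  by rewrite /spin mulN1r ltr0_norm // opprK.
rewrite -mulrBr exprMn spin_sqr mul1r expr_le1 // ?subr_ge0 //.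
by rewrite lerBlDr addrC natr1 ltW.
Qed.

(* Splitting a vector of norm [5 sqrt N] into its lattice part and a remainder of norm at
   most [sqrt N] controls the form by its values on the net plus half its own bound. *)
Lemma net_contraction (M : 'I_N -> 'I_N -> R) (kappa tau : R) :
  0 <= tau -> (forall i j, M i j = M j i) ->
  (forall z : lattice, nrm2 (lval z) <= 25 * N%:R ->
     `|qform M (lval z)| <= kappa * (25 * N%:R)) ->
  (forall y, `|qform M y| <= tau * nrm2 y) ->
  forall y, `|qform M y| <= (kappa + tau / 2) * nrm2 y.
Proof.
move=> tau0 Msym Hnet Htau y.
have [y0|yN] := eqVneq (nrm2 y) 0.
  by have := Htau y; rewrite y0 !mulr0.
have yp : 0 < nrm2 y by rewrite lt_neqAle eq_sym yN nrm2_ge0.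
have Np : 0 < N%:R :> R.
  rewrite ltr0n; case: (posnP N) => // N0; move: yN; rewrite /nrm2 big1 ?eqxx // => i.
  by have : (i < 0)%N by rewrite -[X in (_ < X)%N]N0 ltn_ord.
suff H : forall u, nrm2 u = 25 * N%:R -> `|qform M u| <= (kappa + tau / 2) * (25 * N%:R).
  set c := Num.sqrt (25 * N%:R / nrm2 y).
  have c2 : c ^+ 2 = 25 * N%:R / nrm2 y.
    by rewrite sqr_sqrtr // divr_ge0 ?nrm2_ge0 // mulr_ge0 // ltW.
  have cp : 0 < c ^+ 2 by rewrite c2 divr_gt0 // mulr_gt0.
  have := H (fun i => c * y i); rewrite nrm2Z qformZ normrM (ger0_norm (ltW cp)).
  rewrite {1}c2 divfK // => /(_ erefl).
  have -> : 25 * N%:R = c ^+ 2 * nrm2 y by rewrite c2 divfK.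
  by rewrite mulrCA ler_pM2l.
move=> u u2; have [|z [zu uz]] := @lattice_round u; first by rewrite u2.
rewrite u2 in zu; set d := fun i => u i - lval z i.
have uE : u = fun i => lval z i + 1 * d i.
  by apply/funext => i; rewrite mul1r addrC subrK.
have qu : qform M u = qform M (lval z) + 2 * bform M d (lval z) + qform M d.
  by rewrite {1}uE qformD // expr1n mulr1 mul1r.
have qd := Htau d; have qz := Hnet z zu.
(* Polarisation with weight 5, the ratio of the two norms: the squared norms add up to at most
   [100 N], so twice the bilinear term is at most [10 tau N]. With the remainder this makes
   [11 tau N], below [(tau / 2) * 25 N]. *)
have qp := Htau (fun i => lval z i + 5 * d i).
have qm := Htau (fun i => lval z i + (- 5) * d i).
have par : nrm2 (fun i => lval z i + 5 * d i) + nrm2 (fun i => lval z i + (- 5) * d i) =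
    2 * nrm2 (lval z) + 50 * nrm2 d.
  by rewrite /nrm2 !mulr_sumr -!big_split; apply: eq_bigr => i _ /=; ring.
rewrite qformD // in qp; rewrite qformD // in qm.
have cross : 20 * `|bform M d (lval z)| <= tau * (100 * N%:R).
  have -> : 20 * `|bform M d (lval z)| = `|20 * bform M d (lval z)|.
    by rewrite normrM (@ger0_norm _ 20).
  move: qp qm; rewrite !ler_norml => /andP[p1 p2] /andP[m1 m2].
  have := ler_wpM2l tau0 zu; have := ler_wpM2l tau0 uz.
  set A := nrm2 (fun i => lval z i + 5 * d i) in par p1 p2.
  set A' := nrm2 _ in par m1 m2.
  have : tau * (A + A') = tau * (2 * nrm2 (lval z) + 50 * nrm2 d) by rewrite par.
  move=> e1 e2 e3; apply/andP; split; lra.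
have qd' := le_trans qd (ler_wpM2l tau0 uz).
rewrite qu; apply: le_trans (ler_normD _ _) _.
apply: le_trans (lerD (ler_normD _ _) (lexx _)) _.
rewrite normrM (@ger0_norm _ 2) //.
have : 0 <= tau * N%:R by rewrite mulr_ge0 // ltW.
lra.
Qed.

(** Starting from the crude bound by the sum of the absolute entries, the contraction
    [tau -> kappa + tau / 2] is iterated; its fixed point is [2 kappa]. *)
Lemma net_bound (M : 'I_N -> 'I_N -> R) (kappa : R) :
  0 <= kappa -> (forall i j, M i j = M j i) ->
  (forall z : lattice, nrm2 (lval z) <= 25 * N%:R ->
     `|qform M (lval z)| <= kappa * (25 * N%:R)) ->
  forall y, `|qform M y| <= 2 * kappa * nrm2 y.
Proof.
move=> k0 Msym Hnet y; pose tau := \sum_i \sum_j `|M i j|.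
have tau0 : 0 <= tau by apply: sumr_ge0 => i _; apply: sumr_ge0.
have H n : forall y, `|qform M y| <= (2 * kappa + tau / 2 ^+ n) * nrm2 y.
  elim: n => [|n IH] {}y.
    apply: (@le_trans _ _ (tau * nrm2 y)); last first.
      by rewrite expr0 divr1 ler_wpM2r ?nrm2_ge0 // lerDr mulr_ge0.
    rewrite /tau mulr_suml; apply: le_trans (ler_norm_sum _ _ _) _.
    apply: ler_sum => i _; rewrite mulr_suml; apply: le_trans (ler_norm_sum _ _ _) _.
    apply: ler_sum => j _; rewrite -mulrA normrM ler_wpM2l //.
    have sq m : y m ^+ 2 <= nrm2 y.
      by rewrite /nrm2 (bigD1 m) //= lerDl; apply: sumr_ge0 => ? _; exact: sqr_ge0.
    have := sq i; have := sq j; have := sqr_ge0 (y i + y j); have := sqr_ge0 (y i - y j).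
    by rewrite ler_norml => *; apply/andP; split; nra.
  have t0 : 0 <= 2 * kappa + tau / 2 ^+ n by rewrite addr_ge0 ?mulr_ge0 ?invr_ge0 ?exprn_ge0.
  apply: le_trans (net_contraction t0 Msym Hnet IH y) _.
  have p0 : 2 ^+ n != 0 :> R by rewrite expf_neq0.
  rewrite le_eqVlt; apply/orP; left; apply/eqP; congr (_ * _).
  by rewrite exprS; field.
apply/ler_addgt0Pr => e e0.
pose n := (Num.truncn (tau * nrm2 y / e)).+1.
apply: le_trans (H n y) _; rewrite mulrDl lerD2l mulrAC ler_pdivrMr ?exprn_gt0 //.
rewrite [e * _]mulrC -ler_pdivrMr //; apply: (@le_trans _ _ n%:R); first exact/ltW/truncnS_gt.
by rewrite -natrX ler_nat ltnW // ltn_expl.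
Qed.

(** In the ball the magnitudes sum to at most [25 N], so the indicator is below [2^(25 N)] times the
    product of [2^(-|z_i|)]. Each coordinate then sums to at most 4, including both signs. *)
Lemma lattice_count :
  (\sum_(z : lattice) (nrm2 (lval z) <= 25 * N%:R)%R%:R : R) <= 2 ^+ (27 * N).
Proof.
pose f (p : bool * 'I_radius.+1) : R := 2^-1 ^+ p.2.
have f0 p : 0 <= f p by rewrite exprn_ge0.
apply: (@le_trans _ _ (2 ^+ radius * \sum_(z : lattice) \prod_i f (z i))).
  rewrite mulr_sumr; apply: ler_sum => z _.
  have [zr|_] := leP (nrm2 (lval z)) _; last first.
    by rewrite mulr_ge0 ?exprn_ge0 // prodr_ge0.
  rewrite /f prodrXr exprVn.
  have nle : (\sum_i (z i).2 <= radius)%N.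
    rewrite -(ler_nat R) natrM; apply: le_trans zr; rewrite natr_sum.
    apply: ler_sum => i _; rewrite lval_sqr -natrX ler_nat.
    by case: (nat_of_ord _) => // m; rewrite leq_pmulr.
  by rewrite ler_pdivlMr ?exprn_gt0 // mul1r ler_eXn2l // ltr1n.
rewrite -(bigA_distr_bigA (fun _ => f)) /= prodr_const card_ord.
have fs : \sum_p f p <= 4.
  rewrite -(pair_bigA _ (fun (b : bool) (n : 'I_radius.+1) => 2^-1 ^+ n)) /= big_bool /=.
  have geom m : \sum_(n < m) (2^-1 : R) ^+ n = 2 - 2 * 2^-1 ^+ m.
    elim: m => [|m IH]; first by rewrite big_ord0 expr0; lra.
    by rewrite big_ord_recr /= IH exprS; field.
  have : 0 <= (2^-1 : R) ^+ radius.+1 by rewrite exprn_ge0.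
  by rewrite geom; lra.
rewrite (_ : 27 * N = radius + 2 * N)%N; last by rewrite -mulnDl.
rewrite exprD (exprM _ 2 N) ler_wpM2l ?exprn_ge0 // lerXn2r ?nnegrE ?sumr_ge0 //.
by apply: le_trans fs _; rewrite expr2; lra.
Qed.

End Net.

(** * Gaussian expectations *)

Section GaussianExpectation.
Variable R : realType.
Local Notation N01 := (normal_prob (0 : R) 1).

(** Completing the square turns [exp(a x)] times the standard density into [exp(a^2/2)] times the
    density centred at [a]. *)
Lemma normal_exp_integral (a : R) :
  (\int[N01]_x (expR (a * x))%:E = (expR (a ^+ 2 / 2))%:E)%E.
Proof.
have dom : N01 `<< lebesgue_measure by exact: normal_prob_dominates.
have mexp : measurable_fun setT (fun x : measurableTypeR R => expR (a * x)).
  by apply: measurableT_comp => //; exact: measurable_funM.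
have eexp0 (x : R) : (0 <= (expR (a * x))%:E)%E by rewrite lee_fin expR_ge0.
have meexp : measurable_fun setT (fun x : measurableTypeR R => (expR (a * x))%:E)
  by exact/measurable_EFinP.
rewrite -(Radon_Nikodym_SigmaFinite.change_of_variables dom eexp0 measurableT meexp).
transitivity (\int[lebesgue_measure]_x
    ((expR (a * x))%:E * (normal_pdf 0 1 x)%:E))%E.
  apply: ae_eq_integral => //.
  - apply: emeasurable_funM; first exact/measurable_EFinP.
    exact: measurable_int (Radon_Nikodym_SigmaFinite.f_integrable dom).
  - apply: emeasurable_funM; first exact/measurable_EFinP.
    by apply/measurable_EFinP; exact: measurable_normal_pdf.
  (* The Radon-Nikodym derivative agrees almost everywhere with the Gaussian density, since both
     have the same integral over every measurable set. *)
  apply: ae_eqe_mul2l; apply: integral_ae_eq => //.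
  - exact: Radon_Nikodym_SigmaFinite.f_integrable.
  - by apply/measurable_EFinP; exact: measurable_normal_pdf.
  - by move=> E _ mE; rewrite -Radon_Nikodym_SigmaFinite.f_integral.
under eq_integral => x _.
  have -> : ((expR (a * x))%:E * (normal_pdf 0 1 x)%:E =
             (expR (a ^+ 2 / 2))%:E * (normal_pdf a 1 x)%:E)%E.
    rewrite -!EFinM !normal_pdfE ?oner_eq0 // /normal_fun; congr EFin.
    rewrite ![_ * (normal_peak _ * _)]mulrCA; congr (_ * _).
    by rewrite -!expRD; congr expR; field.
  over.
rewrite integralZl //=; last exact: integrable_normal_pdf.
by rewrite integral_normal_pdf mule1.
Qed.

Lemma normal_exp_integrable (a : R) :
  N01.-integrable setT (fun x => (expR (a * x))%:E).
Proof.
apply/integrableP; split.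
  by apply/measurable_EFinP; apply: measurableT_comp => //; exact: measurable_funM.
under eq_integral do rewrite /= ger0_norm ?expR_ge0 //.
by rewrite normal_exp_integral ltry.
Qed.

Lemma normal_exp_sum_integrable (I : finType) (c a : I -> R) :
  N01.-integrable setT (fun x => (\sum_i c i * expR (a i * x))%:E).
Proof.
under eq_fun do rewrite -sumEFin.
apply: integrable_sum => // i _.
under eq_fun do rewrite EFinM.
by apply: integrableZl => //; exact: normal_exp_integrable.
Qed.

Lemma normal_exp_sum (I : finType) (c a : I -> R) :
  \int[N01]_x (\sum_i c i * expR (a i * x)) =
  \sum_i c i * expR (a i ^+ 2 / 2).
Proof.
rewrite /Rintegral; under eq_integral do rewrite -sumEFin.
rewrite integral_sum //; last first.
  move=> i; under eq_fun do rewrite EFinM.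
  by apply: integrableZl => //; exact: normal_exp_integrable.
under eq_bigr => i _.
  under eq_integral do rewrite EFinM.
  rewrite integralZl //; last exact: normal_exp_integrable.
  rewrite normal_exp_integral -EFinM; over.
by rewrite sumEFin.
Qed.

(** Sequential continuity for coordinatewise convergence, the notion that dominated convergence
    carries through the iterated integral. *)
Definition seq_continuous (F : (nat -> R) -> R) := forall (u : nat -> nat -> R) l,
  (forall k, u n k @[n --> \oo] --> l k) -> F (u n) @[n --> \oo] --> F l.

Lemma bounded_continuous_integrable (f : R -> R) K : continuous f ->
  (forall x, `|f x| <= K) -> N01.-integrable setT (EFin \o f).
Proof.
move=> cf fK; apply: (@le_integrable _ _ _ _ _ _ _ (fun=> K%:E)) => //.
- by apply/measurable_EFinP; exact: continuous_measurable_fun.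
- by move=> x _ /=; rewrite lee_fin (le_trans (fK x)) // ler_norm.
- exact: finite_measure_integrable_cst.
Qed.

Definition fix_coord n (x : R) (g : nat -> R) := fun k => if k == n then x else g k.

Lemma seq_continuous_fix F n x : seq_continuous F -> seq_continuous (F \o fix_coord n x).
Proof.
move=> cF u l ul; apply: cF => k; rewrite /fix_coord.
by case: (k == n); [exact: cvg_cst | exact: ul].
Qed.

(** Both claims go into one induction: convergence at level [n] makes the inner integral continuous
    in the next variable, hence measurable, and the bound supplies the dominating constant. *)
Lemma gauss_exp_bounded n : forall F K, seq_continuous F -> (forall g, `|F g| <= K) ->
    `|gauss_exp n F| <= K /\
    forall Fj : nat -> (nat -> R) -> R, (forall j, seq_continuous (Fj j)) ->
      (forall j g, `|Fj j g| <= K) ->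
      (forall g, Fj j g @[j --> \oo] --> F g) ->
      gauss_exp n (Fj j) @[j --> \oo] --> gauss_exp n F.
Proof.
elim: n => [|n IH] F K cF bF /=; first by split=> // Fj cFj bFj FjF; exact: FjF.
pose G F' := fun x => gauss_exp n (F' \o fix_coord n x).
have GK F' : seq_continuous F' -> (forall g, `|F' g| <= K) -> forall x, `|G F' x| <= K.
  move=> c b x; have [] := IH (F' \o fix_coord n x) K; last by [].
  - exact: seq_continuous_fix.
  - by move=> g; exact: b.
have cG F' : seq_continuous F' -> (forall g, `|F' g| <= K) -> continuous (G F').
  move=> c b x; apply/(@cvg_nbhsP R R^o) => y yx.
  have [] := IH (F' \o fix_coord n x) K.
  - exact: seq_continuous_fix.
  - by move=> g; exact: b.
  move=> _; apply.
  - by move=> j; exact: seq_continuous_fix.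
  - by move=> j g; exact: b.
  - move=> g; apply: c => k; rewrite /fix_coord.
    by case: (k == n); [exact: yx | exact: cvg_cst].
have iG F' : seq_continuous F' -> (forall g, `|F' g| <= K) ->
    N01.-integrable setT (EFin \o G F').
  by move=> c b; apply: (@bounded_continuous_integrable _ K); [exact: cG | exact: GK].
have K0 : 0 <= K by exact: le_trans (normr_ge0 _) (bF (fun=> 0)).
split.
  apply: le_trans (le_normr_Rintegral _ _) _ => //; first exact: iG.
  apply: (@le_trans _ _ (\int[N01]_x K)).
    apply: le_Rintegral => //.
    - exact: (integrable_norm (iG F cF bF)).
    - exact: finite_measure_integrable_cst.
    - by move=> x _; exact: GK.
  by rewrite Rintegral_cst //= probability_setT mulr1.
move=> Fj cFj bFj FjF.
rewrite /Rintegral; apply: fine_cvg.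
rewrite fineK; last first.
  by apply: integrable_fin_num => //; exact: iG.
have [|||||_ _] := @dominated_convergence _ _ _ N01 setT measurableT
  (fun j x => (G (Fj j) x)%:E) (fun x => (G F x)%:E) (fun=> K%:E).
- by move=> j; apply/measurable_EFinP; apply: continuous_measurable_fun; exact: cG.
- by apply/measurable_EFinP; apply: continuous_measurable_fun; exact: cG.
- apply: aeW => x _; apply: cvg_EFin; first exact: nearW.
  have [] := IH (F \o fix_coord n x) K; [exact: seq_continuous_fix | by move=> g; exact: bF |].
  move=> _; apply => //.
  - by move=> j; exact: seq_continuous_fix.
  - by move=> j g; exact: bFj.
  - by move=> g; exact: FjF.
- exact: finite_measure_integrable_cst.
- by apply: aeW => x j _; rewrite lee_fin; exact: GK.
- by [].
Qed.

(** Finite sums of exponentials of linear forms are stable under integrating out one coordinate, so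
    monotonicity of the integral can be used one variable at a time. *)
Lemma gauss_exp_le_exp_sum n : forall (I : finType) (c : I -> R) (a : I -> nat -> R) F K,
  seq_continuous F -> (forall g, `|F g| <= K) ->
  (forall g, F g <= \sum_i c i * expR (\sum_(k < n) a i k * g k)) ->
  gauss_exp n F <= \sum_i c i * expR (\sum_(k < n) a i k ^+ 2 / 2).
Proof.
elim: n => [|n IH] I c a F K cF bF leF /=.
  apply: le_trans (leF (fun=> 0)) _; apply: ler_sum => i _.
  by rewrite !big_ord0.
pose G x := gauss_exp n (F \o fix_coord n x).
have cG : continuous G.
  move=> x; apply/(@cvg_nbhsP R R^o) => y yx.
  have [||_] := @gauss_exp_bounded n (F \o fix_coord n x) K.
  - exact: seq_continuous_fix.
  - by move=> g; exact: bF.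
  apply.
  - by move=> j; exact: seq_continuous_fix.
  - by move=> j g; exact: bF.
  - move=> g; apply: cF => k; rewrite /fix_coord.
    by case: (k == n); [exact: yx | exact: cvg_cst].
pose d i := c i * expR (\sum_(k < n) a i k ^+ 2 / 2).
have leG x : G x <= \sum_i d i * expR (a i n * x).
  apply: le_trans (_ : _ <= \sum_i (c i * expR (a i n * x)) *
                              expR (\sum_(k < n) a i k ^+ 2 / 2)) _; last first.
    by apply: ler_sum => i _; rewrite /d mulrAC.
  apply: (IH I _ a _ K); [exact: seq_continuous_fix | by move=> g; exact: bF |].
  move=> g; apply: le_trans (leF _) _; apply: ler_sum => i _.
  rewrite -mulrA -expRD big_ord_recr /= /fix_coord eqxx addrC.
  rewrite (eq_bigr (fun k : 'I_n => a i k * g k)) // => k _.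
  by rewrite ltn_eqF.
apply: (@le_trans _ _ (\int[N01]_x (\sum_i d i * expR (a i n * x)))).
  apply: le_Rintegral => //.
  - apply: (@bounded_continuous_integrable _ K) => // x.
    have [] := @gauss_exp_bounded n (F \o fix_coord n x) K; last by [].
    - exact: seq_continuous_fix.
    - by move=> g; exact: bF.
  - exact: normal_exp_sum_integrable.
  - by move=> x _; exact: leG.
rewrite normal_exp_sum; apply: ler_sum => i _.
by rewrite /d -mulrA -expRD big_ord_recr.
Qed.

End GaussianExpectation.

(** * The Sherrington-Kirkpatrick model *)

Section SherringtonKirkpatrick.
Variables (R : realType) (N : nat).
Local Notation cube n := {ffun 'I_n -> bool}.
Local Notation vec := ('I_N -> R).

Definition upper (b : R) (g : nat -> R) (i j : 'I_N) : R :=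
  if (i < j)%N then b * g (i * N + j)%N else 0.

Definition coupling b g i j := upper b g i j + upper b g j i.

Lemma coupling_sym b g i j : coupling b g i j = coupling b g j i.
Proof. exact: addrC. Qed.

Lemma qform_coupling b g (y : vec) :
  qform (coupling b g) y = 2 * \sum_i \sum_j upper b g i j * y i * y j.
Proof.
rewrite /qform /bform mulr_natl mulr2n [in X in _ = _ + X]exchange_big -big_split.
apply: eq_bigr => i _; rewrite -big_split; apply: eq_bigr => j _ /=.
rewrite /coupling; ring.
Qed.

Definition spinv (s : cube N) : vec := fun i => spin R (s i).

Lemma minusHE beta h g (s : cube N) :
  minusH beta h g s =
  2^-1 * qform (coupling (beta / Num.sqrt N%:R) g) (spinv s) + lin (fun=> h) s.
Proof.
rewrite qform_coupling mulrA mulVf // mul1r /minusH /lin -mulr_sumr; congr (_ + _).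
rewrite mulr_sumr; apply: eq_bigr => i _; rewrite mulr_sumr big_mkcond.
by apply: eq_bigr => j _; rewrite /upper; case: ifP => _; rewrite ?mul0r // !mulrA.
Qed.

(** Adding [1/16] on the diagonal makes the form nonnegative and at most [1/8]. As spins square to
    1, this only multiplies all weights by one constant, inverse to [kap], which cancels in the
    Gibbs ratio. *)
Lemma gibbs2_good beta h g (t : vec) k :
  (forall y, `|qform (coupling (beta / Num.sqrt N%:R) g) y| <= 16^-1 * nrm2 y) ->
  nrm2 t = 1 -> (0 < k)%N ->
  gibbs2 beta h g (fun s1 s2 => (lin t s1 - lin t s2) ^+ (2 * k))
    <= (8 * expR 3 * k%:R) ^+ k.
Proof.
set C := coupling _ g => good t1 k0.
pose M i j := C i j + (i == j)%:R * 16^-1.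
have Msym i j : M i j = M j i by rewrite /M /C coupling_sym eq_sym.
have qM y : qform M y = qform C y + 16^-1 * nrm2 y.
  rewrite /qform /bform /nrm2 mulr_sumr -big_split; apply: eq_bigr => i _ /=.
  transitivity (\sum_j (C i j * y i * y j + (i == j)%:R * 16^-1 * y i * y j)).
    by apply: eq_bigr => j _; rewrite /M; ring.
  rewrite big_split /=; congr (_ + _); rewrite (bigD1 i) //= big1 ?addr0 => [|j ji].
    by rewrite eqxx mul1r; ring.
  by rewrite eq_sym (negbTE ji) !mul0r.
have [|v vM] := psd_sum_squares Msym.
  by move=> y; rewrite qM; have := good y; rewrite ler_norml => /andP[]; lra.
have va y : \sum_k dotp (v k) y ^+ 2 <= 8^-1 * nrm2 y.
  by rewrite -vM qM; have := good y; rewrite ler_norml => /andP[]; lra.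
have wb := var_bounded_quadratic va.
set w := fun x => _ in wb.
have w0 x : 0 < w x by exact: expR_gt0.
pose kap : R := expR (- (2^-1 * (16^-1 * N%:R))).
have kap0 : kap != 0 by rewrite gt_eqF ?expR_gt0.
have HE s : expR (minusH beta h g s) = kap * tilt w (fun=> h) s.
  rewrite /tilt /w /kap mulrA -!expRD minusHE -/C; congr (expR (_ + _)).
  have -> : \sum_k lin (v k) s ^+ 2 = qform M (spinv s) by rewrite vM.
  rewrite qM; have -> : nrm2 (spinv s) = N%:R.
    rewrite /nrm2; under eq_bigr do rewrite spin_sqr.
    by rewrite sumr_const card_ord.
  ring.
have pos := cube_sum_gt0 (tilt_gt0 (fun=> h) w0).
rewrite /gibbs2 ler_pdivrMr; last first.
  by rewrite exprn_gt0 // cube_sum_gt0 // => s; exact: expR_gt0.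
have -> : \sum_(s : cube N) expR (minusH beta h g s) = kap * \sum_s tilt w (fun=> h) s.
  by rewrite [RHS]mulr_sumr; apply: eq_bigr => s _; exact: HE.
have -> : \sum_(s1 : cube N) \sum_(s2 : cube N) (lin t s1 - lin t s2) ^+ (2 * k) *
    expR (minusH beta h g s1) * expR (minusH beta h g s2) =
  kap ^+ 2 * \sum_s1 \sum_s2 (lin t s1 - lin t s2) ^+ (2 * k) *
    tilt w (fun=> h) s1 * tilt w (fun=> h) s2.
  rewrite [RHS]mulr_sumr; apply: eq_bigr => s1 _.
  rewrite [RHS]mulr_sumr; apply: eq_bigr => s2 _.
  by rewrite !HE; ring.
rewrite (exprMn 2 kap) [leRHS]mulrCA ler_pM2l ?exprn_gt0 ?expR_gt0 //.
exact: subgaussian_moment.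
Qed.

Lemma gibbs2_le beta h g (f : cube N -> cube N -> R) K :
  (forall s1 s2, 0 <= f s1 s2 <= K) -> 0 <= gibbs2 beta h g f <= K.
Proof.
move=> fK; pose W (s : cube N) := expR (minusH beta h g s).
have W0 s : 0 <= W s by exact: expR_ge0.
have pos : 0 < \sum_s W s by apply: cube_sum_gt0 => s; exact: expR_gt0.
apply/andP; split.
  apply: divr_ge0; last exact: sqr_ge0.
  apply: sumr_ge0 => s1 _; apply: sumr_ge0 => s2 _.
  by have /andP[f0 _] := fK s1 s2; rewrite !mulr_ge0.
rewrite /gibbs2 ler_pdivrMr ?exprn_gt0 // expr2 mulr_suml mulr_sumr.
apply: ler_sum => s1 _; rewrite mulr_sumr mulr_sumr; apply: ler_sum => s2 _.
by rewrite -mulrA ler_wpM2r ?mulr_ge0 //; case/andP: (fK s1 s2).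
Qed.

Lemma lin_diff_le (t : vec) (s1 s2 : cube N) : nrm2 t = 1 ->
  (lin t s1 - lin t s2) ^+ 2 <= 4 * N%:R.
Proof.
move=> t1; have := cauchy_schwarz_sum (fun i => t i)
  (fun i => spin R (s1 i) - spin R (s2 i)) (fun _ : 'I_N => @ler01 R).
have -> : \sum_i 1 * t i * (spin R (s1 i) - spin R (s2 i)) = lin t s1 - lin t s2.
  by rewrite /lin -sumrB; apply: eq_bigr => i _; rewrite mul1r mulrBr.
move=> /le_trans; apply; under eq_bigr do rewrite mul1r.
rewrite -/(nrm2 t) t1 mul1r; apply: (@le_trans _ _ (\sum_(i < N) 4)); last first.
  by rewrite sumr_const card_ord mulr_natr.
apply: ler_sum => i _; rewrite mul1r.
by case: (s1 i); case: (s2 i); rewrite /spin; lra.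
Qed.

Lemma gibbs2_moment_le beta h g (t : vec) k : nrm2 t = 1 ->
  0 <= gibbs2 beta h g (fun s1 s2 => (lin t s1 - lin t s2) ^+ (2 * k))
    <= (4 * N%:R) ^+ k.
Proof.
move=> t1; apply: gibbs2_le => s1 s2; rewrite exprM exprn_ge0 ?sqr_ge0 //=.
by rewrite lerXn2r ?nnegrE ?sqr_ge0 ?mulr_ge0 // lin_diff_le.
Qed.

Lemma seq_continuousM (F G : (nat -> R) -> R) :
  seq_continuous F -> seq_continuous G -> seq_continuous (fun g => F g * G g).
Proof. by move=> cF cG u l ul; apply: cvgM; [exact: cF | exact: cG]. Qed.

Lemma seq_continuousD (F G : (nat -> R) -> R) :
  seq_continuous F -> seq_continuous G -> seq_continuous (fun g => F g + G g).
Proof. by move=> cF cG u l ul; apply: cvgD; [exact: cF | exact: cG]. Qed.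

Lemma seq_continuous_cst (c : R) : seq_continuous (fun=> c).
Proof. by move=> u l ul; exact: cvg_cst. Qed.

Lemma seq_continuous_sum (I : finType) (P : pred I) (F : I -> (nat -> R) -> R) :
  (forall i, seq_continuous (F i)) -> seq_continuous (fun g => \sum_(i | P i) F i g).
Proof.
move=> cF; elim: (index_enum I) => [|i r IH].
  by under eq_fun do rewrite big_nil; exact: seq_continuous_cst.
by under eq_fun do rewrite big_cons; case: (P i) => //; exact: seq_continuousD.
Qed.

Lemma seq_continuous_coord k : seq_continuous (fun g : nat -> R => g k).
Proof. by move=> u l ul; exact: ul. Qed.

Lemma seq_continuous_exp (F : (nat -> R) -> R) :
  seq_continuous F -> seq_continuous (fun g => expR (F g)).
Proof.
by move=> cF u l ul; apply: continuous_cvg; [exact: continuous_expR | exact: cF].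
Qed.

Lemma seq_continuous_minusH (beta h : R) (s : cube N) :
  seq_continuous (fun g => minusH beta h g s).
Proof.
rewrite /minusH; apply: seq_continuousD; last exact: seq_continuous_cst.
apply: seq_continuousM; first exact: seq_continuous_cst.
apply: seq_continuous_sum => i; apply: seq_continuous_sum => j.
apply: seq_continuousM; last exact: seq_continuous_cst.
by apply: seq_continuousM; [exact: seq_continuous_coord | exact: seq_continuous_cst].
Qed.

Lemma seq_continuous_gibbs2 (beta h : R) (f : cube N -> cube N -> R) :
  seq_continuous (fun g => gibbs2 beta h g f).
Proof.
move=> u l ul; rewrite /gibbs2.
have cE (s : cube N) := seq_continuous_exp (@seq_continuous_minusH beta h s).
have cZ := @seq_continuous_sum _ xpredT _ cE.
have cN : seq_continuous (fun g => \sum_(s1 : cube N) \sum_(s2 : cube N)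
    f s1 s2 * expR (minusH beta h g s1) * expR (minusH beta h g s2)).
  apply: seq_continuous_sum => s1; apply: seq_continuous_sum => s2.
  by apply: seq_continuousM (cE s2); apply: seq_continuousM (cE s1); exact: seq_continuous_cst.
apply: cvgM; first exact: cN.
apply: cvgV; last exact: (seq_continuousM cZ cZ).
by rewrite expf_neq0 // gt_eqF // cube_sum_gt0 // => s; exact: expR_gt0.
Qed.

End SherringtonKirkpatrick.

(** * The majorant over the disorder and its Gaussian expectation *)

Section Assembly.
Variables (R : realType) (N : nat).
Local Notation cube n := {ffun 'I_n -> bool}.
Local Notation vec := ('I_N -> R).

(** Coordinate of [y] at a natural number; beyond the range the sum is empty and gives zero. *)
Definition ext (y : vec) (m : nat) := \sum_(i < N | i == m :> nat) y i.

Lemma extE y (i : 'I_N) : ext y i = y i.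
Proof. by rewrite /ext (big_pred1 i). Qed.

(** Quotient and remainder by [N] decode the flat index of [g] into a pair, and only pairs in
    increasing order count. *)
Definition pair_coef (y : vec) (m : nat) :=
  if (m %/ N < m %% N)%N then ext y (m %/ N) * ext y (m %% N) else 0.

Lemma pair_coefE y (i j : 'I_N) :
  pair_coef y (i * N + j) = if (i < j)%N then y i * y j else 0.
Proof.
have N0 : (0 < N)%N by case: N i => // -[].
by rewrite /pair_coef divnMDl // divn_small // addn0 modnMDl modn_small // !extE.
Qed.

Lemma sum_pair_index (F : nat -> R) :
  \sum_(m < N * N) F m = \sum_(i < N) \sum_(j < N) F (i * N + j)%N.
Proof.
rewrite -(big_mkord xpredT F) big_nat_mul big_mkord; apply: eq_bigr => i _.
rewrite mulSn -{1}[(i * N)%N]add0n big_addn addnK big_mkord.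
by apply: eq_bigr => j _; rewrite addnC.
Qed.

Lemma qform_coupling_linear b g (y : vec) :
  qform (coupling b g) y = \sum_(m < N * N) 2 * b * pair_coef y m * g m.
Proof.
rewrite (sum_pair_index (fun m => 2 * b * pair_coef y m * g m)) qform_coupling mulr_sumr.
apply: eq_bigr => i _; rewrite mulr_sumr; apply: eq_bigr => j _.
by rewrite pair_coefE /upper; case: ifP => _; [ring | rewrite !(mulr0, mul0r)].
Qed.

Lemma sum_pair_coef_sqr (y : vec) :
  \sum_(m < N * N) pair_coef y m ^+ 2 <= nrm2 y ^+ 2.
Proof.
rewrite (sum_pair_index (fun m => pair_coef y m ^+ 2)) expr2 /nrm2 mulr_suml.
apply: ler_sum => i _; rewrite mulr_sumr; apply: ler_sum => j _.
rewrite pair_coefE; case: ifP => _; first by rewrite exprMn.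
by rewrite expr0n mulr_ge0 ?sqr_ge0.
Qed.

(** The inequality [N/k <= exp(N/k)] raised to the power [k]. *)
Lemma pow_le_exp k : (0 < k)%N -> N%:R ^+ k <= k%:R ^+ k * expR N%:R :> R.
Proof.
move=> k0; have kp : 0 < k%:R :> R by rewrite ltr0n.
have -> : expR N%:R = expR (N%:R / k%:R) ^+ k :> R.
  by rewrite -expRM_natl mulrC divfK // gt_eqF.
rewrite -exprMn lerXn2r ?nnegrE // ?mulr_ge0 ?expR_ge0 //.
rewrite mulrC -ler_pdivrMr //; apply: le_trans (expR_ge1Dx _); lra.
Qed.

Lemma exprn_superadd (x y : R) k : 0 <= x -> 0 <= y -> (0 < k)%N ->
  x ^+ k + y ^+ k <= (x + y) ^+ k.
Proof.
case: k => // k x0 y0 _; rewrite !exprS mulrDl.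
apply: lerD; rewrite ler_wpM2l // lerXn2r ?nnegrE ?addr_ge0 //.
  by rewrite lerDl.
by rewrite lerDr.
Qed.

(* The majorant of the 2k-th moment: [None] is the constant valid on the good event, and
   [Some (b, z)] is the exponential Markov bound, with parameter 40, for the event that
   the quadratic form at the net point [z] exceeds [25 N / 32] with sign [b]. *)
Definition bound_index := option (bool * lattice N).

Definition bound_coef k (i : bound_index) : R :=
  if i is Some p then
    (nrm2 (@lval R N p.2) <= 25 * N%:R)%R%:R * ((4 * N%:R) ^+ k * expR (- (125 / 4 * N%:R)))
  else (8 * expR 3 * k%:R) ^+ k.

Definition bound_slope b (i : bound_index) (m : nat) : R :=
  if i is Some p then spin R p.1 * 40 * (2 * b * pair_coef (lval R p.2) m) else 0.

Lemma bound_coef_ge0 k i : 0 <= bound_coef k i.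
Proof.
case: i => [p|] /=; last by rewrite exprn_ge0 // !mulr_ge0 // expR_ge0.
by rewrite !mulr_ge0 ?exprn_ge0 ?expR_ge0 // mulr_ge0.
Qed.

(** If the form is small on the whole net, [net_bound] with [1/32] gives the norm [1/16] and the
    [None] term suffices. Otherwise the term of one bad net point, with the right sign, already
    exceeds the trivial bound. *)
Lemma gibbs2_le_bound beta h g (t : vec) k : nrm2 t = 1 -> (0 < k)%N ->
  gibbs2 beta h g (fun s1 s2 => (lin t s1 - lin t s2) ^+ (2 * k)) <=
  \sum_i bound_coef k i *
    expR (\sum_(m < N * N) bound_slope (beta / Num.sqrt N%:R) i m * g m).
Proof.
move=> t1 k0; set b := beta / _.
set T := fun i => bound_coef k i * expR (\sum_(m < N * N) bound_slope b i m * g m).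
have T0 i : 0 <= T i by rewrite mulr_ge0 ?bound_coef_ge0 ?expR_ge0.
have one i : T i <= \sum_i T i.
  by rewrite (bigD1 i) //= lerDl; apply: sumr_ge0.
pose q (y : vec) := qform (coupling b g) y.
have [good|bad] := pselect (forall z : lattice N, nrm2 (lval R z) <= 25 * N%:R ->
    `|q (lval R z)| <= 32^-1 * (25 * N%:R)).
  apply: le_trans (one None); rewrite /T /= big1 => [|m _]; last by rewrite mul0r.
  rewrite expR0 mulr1; apply: gibbs2_good => // y.
  have -> : 16^-1 = 2 * 32^-1 :> R by field.
  by apply: net_bound => // i j; exact: coupling_sym.
have [z] : exists z : lattice N, ~ (nrm2 (lval R z) <= 25 * N%:R ->
    `|q (lval R z)| <= 32^-1 * (25 * N%:R)) by exact/existsNP.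
move=> /not_implyP[zr /negP]; rewrite -ltNge => zq.
have /andP[_ le4N] := gibbs2_moment_le beta h g k t1.
apply: le_trans le4N _; apply: le_trans (one (Some (0 <= q (lval R z), z))).
rewrite /T /= zr mul1r -mulrA -expRD ler_peMr ?exprn_ge0 ?mulr_ge0 //.
(* The exponent is 40 times the excess of the form over [25 N / 32]; this is the origin of
   [125/4 = 40 * 25/32]. *)
rewrite -[leLHS]expR0 ler_expR.
have -> : \sum_(m < N * N) spin R (0 <= q (lval R z)) * 40 *
     (2 * b * pair_coef (lval R z) m) * g m = 40 * `|q (lval R z)|.
  have -> : `|q (lval R z)| = spin R (0 <= q (lval R z)) * q (lval R z).
    have [q0|q0] := leP 0 (q (lval R z)); first by rewrite /spin mul1r ger0_norm.
    by rewrite /spin mulN1r ltr0_norm.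
  rewrite [X in _ = 40 * (_ * X)]qform_coupling_linear !mulr_sumr; apply: eq_bigr => m _; ring.
lra.
Qed.

(** A union bound: at most [2 * 2^(27 N)] terms, each [(4 N)^k exp(- 121 N / 4)], and
    [2^(27 N) <= exp(27 N)] leaves more than the [exp(- N)] that turns [N^k] into [k^k]. *)
Lemma bound_value b beta k : 0 < beta -> beta <= 2000^-1 -> b ^+ 2 * N%:R <= beta ^+ 2 ->
  (0 < k)%N ->
  \sum_i bound_coef k i * expR (\sum_(m < N * N) bound_slope b i m ^+ 2 / 2) <=
  ((8 * expR 3 + 8) * k%:R) ^+ k.
Proof.
move=> beta0 betale bN k0; set C := 8 * expR 3.
have N0 : 0 <= N%:R :> R by [].
rewrite (bigD1 None) //= -/C.
rewrite big1 ?expR0 ?mulr1 => [|m _]; last by rewrite /= expr0n mul0r.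
set E : R := (4 * N%:R) ^+ k * expR (- (121 / 4 * N%:R)).
have E0 : 0 <= E by rewrite mulr_ge0 ?expR_ge0 // exprn_ge0 // mulr_ge0.
have term p : bound_coef k (Some p) *
    expR (\sum_(m < N * N) bound_slope b (Some p) m ^+ 2 / 2) <=
    (nrm2 (@lval R N p.2) <= 25 * N%:R)%R%:R * E.
  rewrite /=; have [zr|_] := leP (nrm2 _) (25 * N%:R); last by rewrite !mul0r.
  rewrite !mul1r -mulrA -expRD /E ler_wpM2l ?exprn_ge0 ?mulr_ge0 // ler_expR.
  have -> : \sum_(m < N * N) (spin R p.1 * 40 * (2 * b * pair_coef (lval R p.2) m)) ^+ 2 / 2
      = 3200 * b ^+ 2 * \sum_(m < N * N) pair_coef (lval R p.2) m ^+ 2.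
    rewrite mulr_sumr; apply: eq_bigr => m _.
    by rewrite !exprMn spin_sqr; field.
  have b2 : 0 <= 3200 * b ^+ 2 by exact: mulr_ge0 (ler0n _ _) (sqr_ge0 _).
  have h1 := ler_wpM2l b2 (sum_pair_coef_sqr (lval R p.2)).
  have h2 : nrm2 (lval R p.2) ^+ 2 <= (25 * N%:R) ^+ 2.
    by rewrite ler_sqr ?nnegrE ?nrm2_ge0 ?mulr_ge0.
  have := ler_wpM2l b2 h2.
  (* The Gaussian exponent is at most [3200 * b^2 * (25 N)^2 <= N / 2], within the gap [N] between
     [125 N / 4] and [121 N / 4]. *)
  have h3 : beta ^+ 2 <= 2000^-1 * 2000^-1.
    by rewrite expr2; apply: ler_pM => //; exact: ltW.
  move=> h4; have h5 := ler_wpM2r N0 (le_trans bN h3).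
  lra.
have rest : \sum_(i | i != None) bound_coef k i *
    expR (\sum_(m < N * N) bound_slope b i m ^+ 2 / 2) <= 2 * (2 ^+ (27 * N) * E).
  rewrite (reindex_omap Some id) => [|[p|]] //=.
  rewrite (eq_bigl xpredT) => [|p]; last by rewrite eqxx.
  apply: le_trans (ler_sum _ (fun p _ => term p)) _.
  rewrite -(pair_bigA _ (fun (_ : bool) (z : lattice N) =>
    (nrm2 (@lval R N z) <= 25 * N%:R)%R%:R * E)) /= big_bool /= -mulr_suml.
  have := ler_wpM2r E0 (lattice_count R N); lra.
have small : 2 ^+ (27 * N) * E <= (4 * k%:R) ^+ k.
  have e2 : 2 ^+ (27 * N) <= expR (27 * N%:R) :> R.
    have -> : 27 * N%:R = (27 * N)%:R * 1 :> R by rewrite natrM mulr1.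
    by rewrite expRM_natl lerXn2r ?nnegrE ?expR_ge0 //; apply: le_trans (expR_ge1Dx 1); lra.
  apply: le_trans (ler_wpM2r E0 e2) _; rewrite /E mulrCA -expRD.
  rewrite !(exprMn k 4) -[leLHS]mulrA ler_wpM2l ?exprn_ge0 //.
  apply: (@le_trans _ _ (N%:R ^+ k * expR (- N%:R))).
    by rewrite ler_wpM2l ?exprn_ge0 // ler_expR; lra.
  by rewrite expRN ler_pdivrMr ?expR_gt0 // pow_le_exp.
have C0 : 0 <= C by rewrite mulr_ge0 // expR_ge0.
apply: (@le_trans _ _ ((C * k%:R) ^+ k + (8 * k%:R) ^+ k)).
  rewrite lerD2l; apply: le_trans rest _; apply: (@le_trans _ _ (2 * (4 * k%:R) ^+ k)).
    by rewrite ler_wpM2l.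
  have -> : 8 * k%:R = 2 * (4 * k%:R) :> R by ring.
  rewrite [leRHS]exprMn ler_wpM2r ?exprn_ge0 ?mulr_ge0 //.
  by rewrite -[leLHS]expr1 ler_eXn2l // ltr1n.
by rewrite [(C + 8) * _]mulrDl; apply: exprn_superadd; rewrite ?mulr_ge0.
Qed.

End Assembly.

Theorem theorem2 (R : realType) :
  exists beta0 : R, exists L : R, 0 < beta0 /\ 0 < L /\
    forall (beta h : R) (N : nat) (t : 'I_N -> R) (k : nat),
      0 < beta -> beta <= beta0 -> 0 <= h -> (1 <= N)%N ->
      \sum_(i < N) t i ^+ 2 = 1 -> (1 <= k)%N ->
      nu2 beta h (fun s1 s2 => (\sum_(i < N) t i * (spin R (s1 i) - spin R (s2 i))) ^+ (2 * k))
        <= (L * k%:R) ^+ k.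
Proof.
(* In [L], the part [8 exp 3] is the moment bound for variance constant 3 and the other 8 pays for
   the bad event; [1/2000] keeps the Gaussian exponent of the union bound below [N]. *)
exists 2000^-1, (8 * expR 3 + 8); split; first by rewrite invr_gt0 ltr0n.
split; first by rewrite addr_gt0 // mulr_gt0 ?expR_gt0.
move=> beta h N t k beta0 betale _ N1 t1 k1.
have -> : (fun s1 s2 : {ffun 'I_N -> bool} =>
    (\sum_(i < N) t i * (spin R (s1 i) - spin R (s2 i))) ^+ (2 * k)) =
    fun s1 s2 => (lin t s1 - lin t s2) ^+ (2 * k).
  apply/funext => s1; apply/funext => s2; congr (_ ^+ _).
  by rewrite /lin -sumrB; apply: eq_bigr => i _; rewrite mulrBr.
apply: (@le_trans _ _ (\sum_i bound_coef R k i *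
    expR (\sum_(m < N * N) bound_slope (beta / Num.sqrt N%:R) i m ^+ 2 / 2))).
  (* The trivial bound [(4 N)^k], uniform in the disorder, provides integrability. *)
  apply: (@gauss_exp_le_exp_sum _ _ _ _ _ _ ((4 * N%:R) ^+ k)).
  - exact: seq_continuous_gibbs2.
  - by move=> g; have /andP[g0 g1] := gibbs2_moment_le beta h g k t1; rewrite ger0_norm.
  - by move=> g; exact: gibbs2_le_bound.
apply: (bound_value beta0 betale _ k1).
by rewrite expr_div_n sqr_sqrtr // divfK // pnatr_eq0 -lt0n.
Qed.
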